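(* Let $\mathcal{P}$ be a univalent circle packing with $\mathrm{carr}(\mathcal{P})=\mathbb{C}$, and let $K$ be its complex. Let $f$ be a cp-map with domain packing $\mathcal{P}$, and let $f^{\#}$ be the associated ratio function. If the 1-skeleton of $K$ is recurrent, then $f^{\#}$ is either unbounded or constant.
   Context: $K$ denotes a simplicial 2-complex given by a triangulation of a domain in $\mathbb{C}$, oriented by the orientation of $\mathbb{C}$, with vertex set $K^{(0)}$, edges $K^{(1)}$ (also denoting the 1-skeleton graph) and faces $K^{(2)}$. A circle packing for $K$ is a collection $\mathcal{P}=\{C_{\mathcal{P}}(v)\}_{v\in K^{(0)}}$ of circles in $\mathbb{C}$ indexed by the vertices such that $\langle C_{\mathcal{P}}(u),C_{\mathcal{P}}(v),C_{\mathcal{P}}(w)\rangle$ is a positively oriented triple of mutually externally tangent circles whenever $\langle u,v,w\rangle\in K^{(2)}$ is a positively oriented triple; $K$ is called the complex of $\mathcal{P}$. The packing is univalent if all its circles have mutually disjoint interiors (this is not required of a general circle packing). The radius function is $r_{\mathcal{P}}(v):=$ radius of $C_{\mathcal{P}}(v)$. The map $S_{\mathcal{P}}:K\to\mathbb{C}$ sends each vertex $v$ to the center of $C_{\mathcal{P}}(v)$ and is extended affinely to edges and faces; the carrier is $\mathrm{carr}(\mathcal{P}):=S_{\mathcal{P}}(K)$, which for univalent $\mathcal{P}$ is regarded as a subset of $\mathbb{C}$. Given two circle packings $\mathcal{P},\mathcal{Q}$ for the same complex $K$, the cp-map from $\mathcal{P}$ (domain packing) to $\mathcal{Q}$ (range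 packing) is the map $f:\mathrm{carr}(\mathcal{P})\to\mathbb{C}$ sending the center of $C_{\mathcal{P}}(v)$ to the center of $C_{\mathcal{Q}}(v)$ for each $v$ and extended affinely to faces; the associated ratio function $f^{\#}:\mathrm{carr}(\mathcal{P})\to(0,\infty)$ is given at vertices by $f^{\#}(S_{\mathcal{P}}(v)):=r_{\mathcal{Q}}(v)/r_{\mathcal{P}}(v)$ and extended affinely to edges and faces. A graph is recurrent if its simple random walk is recurrent, i.e. visits every vertex infinitely many times with probability 1. *)

(* Defs.v *)
From HB Require Import structures.
From mathcomp Require Import all_boot all_order all_algebra.
From mathcomp Require Import finmap.
From mathcomp Require Import all_classical all_reals all_analysis.
From mathcomp Require Import complex.

Set Implicit Arguments.
Unset Strict Implicit.
Unset Printing Implicit Defensive.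

Import Order.TTheory GRing.Theory Num.Theory.
Import numFieldNormedType.Exports.
Import ComplexField.Normc.

Local Open Scope classical_set_scope.
Local Open Scope complex_scope.
Local Open Scope ring_scope.

(* An oriented simplicial 2-complex is given by its positively oriented triples
   <u,v,w>, each face contributing three of them (the rotations of one).  Every
   vertex lies in a face, as is the case for a triangulation of a plane domain;
   the edges are the edges of the faces. *)
Record complex2 (V : choiceType) := Complex2 {
  face :> V -> V -> V -> Prop ;
  face_rot : forall u v w, face u v w -> face v w u ;
  face_neq : forall u v w, face u v w -> u <> v ;
  face_asym : forall u v w, face u v w -> ~ face v u w ;
  face_cover : forall u, exists v w, face u v w
}.

Definition neighbors (V : choiceType) (K : complex2 V) (u : V) : set V :=
  [set v | exists w, K u v w \/ K v u w].

Section Realization.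
Context {R : realType} {V : choiceType}.
Implicit Types (K : complex2 V) (x y : V -> R).

(* |K|, in barycentric coordinates. *)
Definition realization K : set {ptws V -> R} :=
  [set x | exists u v w, [/\ K u v w,
     forall z, 0 <= x z,
     forall z, z <> u -> z <> v -> z <> w -> x z = 0
     & x u + x v + x w = 1]].

Definition vertex (v : V) : V -> R := fun z => (z == v)%:R.

Definition segment x y (t : R) : V -> R := fun z => (1 - t) * x z + t * y z.

(* The boundary u -> v -> w -> u of a face, parametrized by [0, 3]. *)
Definition face_boundary (u v w : V) (t : R) : V -> R :=
  if t <= 1 then segment (vertex u) (vertex v) t
  else if t <= 2 then segment (vertex v) (vertex w) (t - 1)
  else segment (vertex w) (vertex u) (t - 2).

End Realization.

(* The loop g : [0, 3] -> C winds once, counterclockwise, around a: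
   theta is a continuous determination of arg (g - a). *)
Definition winds_once {R : realType} (g : R -> R[i]) (a : R[i]) : Prop :=
  exists theta : R -> R,
    [/\ {within `[0, 3], continuous theta},
        forall t, 0 <= t <= 3 -> g t <> a /\
          g t - a = (normc (g t - a))%:C * (cos (theta t) +i* sin (theta t))
      & theta 3 - theta 0 = 2 * pi].

(* K is a triangulation of a domain D of the complex plane, with the orientation
   of the plane: h is a homeomorphism from |K| onto D, with inverse g, which maps
   the boundaries of positively oriented faces to positively oriented loops.
   |K| has the topology of pointwise convergence of barycentric coordinates,
   which is its metric topology.  A realization homeomorphic to D is locally
   compact for it, so K is locally finite and this is also the weak topology. *)
Definition triangulates {R : realType} {V : choiceType} (K : complex2 V)
    (D : set R[i]^o) (h : {ptws V -> R} -> R[i]^o) : Prop :=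
  (exists g : R[i]^o -> {ptws V -> R},
    [/\ {within realization K, continuous h}, {within D, continuous g},
        forall x, realization K x -> D (h x) /\ g (h x) = x
      & forall z, D z -> realization K (g z) /\ h (g z) = z]) /\
  (forall u v w, K u v w -> forall x : V -> R, realization K x ->
     0 < x u -> 0 < x v -> 0 < x w ->
     winds_once (fun t => h (face_boundary u v w t)) (h x)).

Definition plane_triangulation (R : realType) {V : choiceType}
    (K : complex2 V) : Prop :=
  exists (D : set R[i]^o) (h : {ptws V -> R} -> R[i]^o),
    [/\ open D, connected D, D !=set0 & triangulates K D h].

Section Packings.
Context {R : realType}.

Record circle := Circle {
  circle_center : R[i] ;
  circle_radius : R ;
  circle_radius_gt0 : 0 < circle_radius
}.

Definition circle_interior (c : circle) : set R[i] :=
  [set z | normc (z - circle_center c) < circle_radius c].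

Definition externally_tangent (c d : circle) : Prop :=
  normc (circle_center c - circle_center d) = circle_radius c + circle_radius d.

Definition positively_oriented (a b c : R[i]) : Prop :=
  0 < complex.Im ((c - a) / (b - a)).

Context {V : choiceType}.

Definition circle_packing (K : complex2 V) (P : V -> circle) : Prop :=
  forall u v w, K u v w ->
    [/\ externally_tangent (P u) (P v), externally_tangent (P v) (P w),
        externally_tangent (P w) (P u)
      & positively_oriented (circle_center (P u)) (circle_center (P v))
          (circle_center (P w))].

Definition univalent (P : V -> circle) : Prop :=
  forall u v, u <> v ->
    circle_interior (P u) `&` circle_interior (P v) = set0.

(* The map S_P from |K| to the plane; the sum has at most three nonzero terms. *)
Definition center_map (P : V -> circle) (x : V -> R) : R[i] :=
  \sum_(v \in [set: V]) (x v)%:C * circle_center (P v).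

Definition carrier (K : complex2 V) (P : V -> circle) : set R[i] :=
  [set center_map P x | x in realization K].

(* A function on the carrier which is affine on the image of each face, such as
   a cp-map or its ratio function, is prescribed at the points S_P(x) of the
   carrier, x in |K|; the values outside the carrier are irrelevant. *)
Definition cp_map (K : complex2 V) (P Q : V -> circle) (f : R[i] -> R[i]) :
    Prop :=
  forall x, realization K x -> f (center_map P x) = center_map Q x.

Definition ratio_function (K : complex2 V) (P Q : V -> circle)
    (fs : R[i] -> R) : Prop :=
  forall x, realization K x ->
    fs (center_map P x) =
    \sum_(v \in [set: V]) x v * (circle_radius (Q v) / circle_radius (P v)).

End Packings.

Section RandomWalk.
Context {V : choiceType}.

(* A graph on V is given by its neighborhoods N x; here they are finite. *)
Definition step_probability (R : realType) (N : V -> set V) (x y : V) : R :=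
  \1_(N x) y / #|` fset_set (N x)|%:R.

Definition simple_random_walk (R : realType) (N : V -> set V) (x0 : V)
    (d : measure_display) (T : measurableType d) (Pr : probability T R)
    (X : nat -> T -> V) : Prop :=
  (forall n v, measurable (X n @^-1` [set v])) /\
  (forall n (p : nat -> V),
     Pr [set t | forall i, (i <= n)%N -> X i t = p i] =
     ((p 0 == x0)%:R * \prod_(i < n) step_probability R N (p i) (p i.+1))%:E).

(* The law of the simple random walk started at x0 being determined by
   simple_random_walk, it does not matter on which probability space the walk
   is realized. *)
Definition recurrent (R : realType) (N : V -> set V) : Prop :=
  forall x0, exists (d : measure_display) (T : measurableType d)
    (Pr : probability T R) (X : nat -> T -> V),
    simple_random_walk N x0 Pr X /\
    forall v,
      Pr [set t | forall m, exists2 n, (m <= n)%N & X n t = v] = 1%:E.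

End RandomWalk.

(* Main.v *)
Require Import Defs.
From mathcomp Require Import all_boot all_order all_algebra.
From mathcomp Require Import finmap.
From mathcomp Require Import all_classical all_reals all_analysis.
From mathcomp Require Import complex.
From mathcomp Require Import perm.
From mathcomp Require Import ring lra.

Set Implicit Arguments.
Unset Strict Implicit.
Unset Printing Implicit Defensive.

Import Order.TTheory GRing.Theory Num.Theory.
Import numFieldNormedType.Exports.

Local Open Scope classical_set_scope.
Local Open Scope ring_scope.

(** If u, v are the logarithms of the radii of P and Q, the angles of the faces
    at a vertex x of Q minus those of P add up to at least 0: the petals of x in
    P are disjoint, so they go around x once, while those of Q go around at
    least once. Moving the logarithmic radii on a segment from u to v, this
    difference is sum_y c(x, y) (g(y) - g(x)) with g = v - u and conductances
    c(x, y) = c(y, x) which are at most 1, because the derivative of the angle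
    at x of a face with respect to the logarithm of the radius at y is the
    inradius of the face divided by the length of the edge xy. So g is
    subharmonic on a network whose conductances are bounded by those of the
    simple random walk; by recurrence there are finitely supported cut-off
    functions, the probabilities to hit a vertex by time m, which tend to 1
    and whose Dirichlet energy tends to 0. If the ratio is bounded, h = C - g is
    positive and superharmonic, and testing against phi^2 / h for these cut-off
    functions phi shows that h is constant.

    That every oriented edge of K has exactly one face on its left follows from
    homotopy invariance of winding numbers in the plane. *)

(** * Winding numbers of plane loops *)

(** The network itself is never formed. The intermediate radii given by the mean value theorem
    depend on the weights of the test function, so the estimate is made on one face at a time, for
    prescribed weights, and only bounds on the conductances are kept: a face gives each of its edges
    at most 1/2, and an edge has two faces. The weight phi^2 / h is dictated by the ground state
    transform, which leaves, besides the energy of phi, a negative multiple of (phi x / h x - phi y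
    / h y)^2. Kept on a single edge while phi tends to 1, this term forces 1 / h to agree at both
    ends.

    Topology enters through one combinatorial fact: passing from a petal of x to the next must be a
    well-defined injective map, which asks for the existence and uniqueness of a face on a given
    side of an edge. The angle sums are then compared on each cycle of this map.

    Recurrence gives more than the cut-off functions: it also yields local finiteness, and the link
    between distant vertices by which equality along edges becomes equality everywhere. *)

Section Winding.
Context {R : realType}.
Local Open Scope complex_scope.
Implicit Types (z : R -> R[i]) (theta : R -> R) (a b t : R).

Definition cis (x : R) : R[i] := cos x +i* sin x.

Lemma cisD x y : cis (x + y) = cis x * cis y.
Proof. by rewrite /cis cosD sinD; simpc; congr (_ +i* _); ring. Qed.

Lemma cis0 : cis 0 = 1.
Proof. by rewrite /cis cos0 sin0. Qed.

Definition ccontinuous (T : topologicalType) (z : T -> R[i]) :=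
  continuous (fun p => complex.Re (z p)) /\
  continuous (fun p => complex.Im (z p)).

Definition is_arg z theta :=
  continuous theta /\
  forall t, exists2 rho, 0 < rho & z t = rho%:C * cis (theta t).

Lemma is_argM z z' theta theta' : is_arg z theta -> is_arg z' theta' ->
  is_arg (fun t => z t * z' t) (fun t => theta t + theta' t).
Proof.
move=> [ct face_point] [ct' pt']; split=> [t|t]; first exact: (cvgD (ct t) (ct' t)).
have [r r0 ->] := face_point t; have [r' r0' ->] := pt' t.
exists (r * r'); first exact: mulr_gt0.
by rewrite cisD rmorphM; ring.
Qed.

Lemma cis_polar_eq r r' (x y : R) : 0 < r -> 0 < r' ->
  r%:C * cis x = r'%:C * cis y -> cos (x - y) = 1.
Proof.
move=> r0 r0'; rewrite /cis; simpc => -[e1 e2].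
have e : r = r'.
  have : r ^+ 2 = r' ^+ 2.
    rewrite -[LHS]mulr1 -(cos2Dsin2 x) -[RHS]mulr1 -(cos2Dsin2 y).
    by rewrite !mulrDr -!exprMn e1 e2.
  by move/eqP; rewrite eqrXn2 ?ltW// => /eqP.
rewrite -{r' r0'}e in e1 e2.
have n0 : r != 0 by rewrite gt_eqF.
move/(mulfI n0): e1 => e1; move/(mulfI n0): e2 => e2.
by rewrite cosB e1 e2 -!expr2 cos2Dsin2.
Qed.

Lemma cos_lt1 (x : R) : 0 < x < 2 * pi -> cos x < 1.
Proof.
move=> /andP[x0 x2].
have -> : x = x / 2 + x / 2 by rewrite -splitr.
have s0 : 0 < sin (x / 2) by apply: sin_gt0_pi; lra.
rewrite cosD; have := cos2Dsin2 (x / 2); nra.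
Qed.

(** The values of [d] lie in the discrete set of multiples of 2 pi. If [d a < d b], the intermediate
    value theorem gives the value [d a + e]; capping [e] at pi keeps it in the range where the
    cosine is less than 1. *)
Lemma cos1_continuous_cst (d : R -> R) a b : a <= b -> continuous d ->
  (forall t, cos (d t) = 1) -> d a = d b.
Proof.
move=> ab cd d1.
have s0 t : sin (d t) = 0.
  apply/eqP; rewrite -sqrf_eq0; apply/eqP.
  by have := cos2Dsin2 (d t); rewrite d1; lra.
wlog : d cd d1 s0 / d a <= d b.
  move=> W; have [|/ltW h] := leP (d a) (d b); first exact: W.
  apply: oppr_inj; apply: (W (fun t => - d t)); rewrite ?lerN2 //.
  - by move=> t; exact: (cvgN (cd t)).
  - by move=> t; rewrite cosN.
  - by move=> t; rewrite sinN s0 oppr0.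
rewrite le_eqVlt => /predU1P[//|lt].
pose e := Num.min pi (d b - d a).
have p0 := pi_gt0 R.
have e0 : 0 < e by rewrite lt_min p0 subr_gt0 lt.
have eb : e <= d b - d a by rewrite ge_min lexx orbT.
have ep : e <= pi by rewrite ge_min lexx.
have cd' : {within `[a, b], continuous d} by exact: continuous_subspaceT.
have [|c _ dc] := @IVT R d a b (d a + e) ab cd'.
  rewrite (min_idPl (ltW lt)) (max_idPr (ltW lt)).
  by apply/andP; split; lra.
have := d1 c; rewrite dc cosD d1 s0 mul1r mul0r subr0 => c1.
by have := @cos_lt1 e; rewrite c1 ltxx => /(_ _)/negP; lra.
Qed.

Lemma is_arg_unique z theta theta' a b : a <= b ->
  is_arg z theta -> is_arg z theta' ->
  theta b - theta a = theta' b - theta' a.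
Proof.
move=> ab [ct face_point] [ct' pt'].
suff : theta a - theta' a = theta b - theta' b by lra.
apply: (@cos1_continuous_cst (fun t => theta t - theta' t) a b ab) => t.
  exact: (cvgB (ct t) (ct' t)).
have [r r0 e] := face_point t; have [r' r0' e'] := pt' t.
by apply: cis_polar_eq r0 r0' _; rewrite -e -e'.
Qed.

Lemma polar_atan (x y : R) : 0 < x ->
  exists2 rho, 0 < rho & x +i* y = rho%:C * cis (atan (y / x)).
Proof.
move=> x0; have c0 : 0 < cos (atan (y / x)).
  by rewrite cos_atan invr_gt0 sqrtr_gt0 ltr_pwDl// sqr_ge0.
exists (x / cos (atan (y / x))); first exact: divr_gt0.
have e := atanK (y / x); rewrite /tan in e.
rewrite /cis; simpc; congr (_ +i* _); first by rewrite divfK ?gt_eqF.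
apply: (@mulIf _ x^-1); first by rewrite invr_eq0 gt_eqF.
rewrite -[LHS]e; field.
by rewrite !gt_eqF.
Qed.


Definition sqn (z : R[i]) : R := complex.Re z ^+ 2 + complex.Im z ^+ 2.

(* The argument in ]-pi/2, pi/2[ of w / z, when |z - w| < |z|. *)
Definition ratio_arg (z w : R[i]) : R :=
  atan ((complex.Im w * complex.Re z - complex.Re w * complex.Im z) /
        (complex.Re w * complex.Re z + complex.Im w * complex.Im z)).

Lemma ratio_argP (z w : R[i]) : sqn (z - w) < sqn z ->
  exists2 rho, 0 < rho & w = rho%:C * cis (ratio_arg z w) * z.
Proof.
rewrite /sqn /ratio_arg; case: z w => x y [u v] /= h.
have p0 : 0 < u * x + v * y by nra.
have n0 : 0 < x ^+ 2 + y ^+ 2.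
  by apply: le_lt_trans h; rewrite addr_ge0 ?sqr_ge0.
have [r r0 e] := @polar_atan _ (v * x - u * y) p0.
exists (r / (x ^+ 2 + y ^+ 2)); first exact: divr_gt0.
move: e; rewrite /cis; simpc; set A := atan _ => -[e1 e2].
have n1 : x ^+ 2 + y ^+ 2 != 0 by rewrite gt_eqF.
congr (_ +i* _).
  transitivity ((r * cos A * x - r * sin A * y) / (x ^+ 2 + y ^+ 2)).
    by rewrite -e1 -e2; field.
  by field.
transitivity ((r * cos A * y + r * sin A * x) / (x ^+ 2 + y ^+ 2)).
  by rewrite -e1 -e2; field.
by field.
Qed.

(** A dog on a short leash: [w t / z t] is within distance 1 of 1, hence in the right half-plane,
    and its principal argument is a continuous correction to [theta]. As both curves are closed, the
    correction is the same at [a] and [b]. *)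
Lemma is_arg_close z w theta a b : ccontinuous z -> ccontinuous w ->
  (forall t, sqn (z t - w t) < sqn (z t)) -> z a = z b -> w a = w b ->
  is_arg z theta ->
  exists2 theta', is_arg w theta' & theta' b - theta' a = theta b - theta a.
Proof.
move=> [cx cy] [cu cv] zw zab wab [ct face_point].
exists (fun t => ratio_arg (z t) (w t) + theta t); last first.
  by rewrite zab wab; lra.
pose q t := (complex.Im (w t) * complex.Re (z t) -
             complex.Re (w t) * complex.Im (z t)) /
            (complex.Re (w t) * complex.Re (z t) +
             complex.Im (w t) * complex.Im (z t)).
have cq : continuous q.
  move=> t; rewrite /q; apply: cvgM.
    by apply: cvgB; apply: cvgM; [exact: cv|exact: cx|exact: cu|exact: cy].
  apply: cvgV.
    have := zw t; rewrite /sqn; case: (z t) (w t) => x y [u v] /= h.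
    by apply/eqP => e0; clear -h e0; nra.
  by apply: cvgD; apply: cvgM; [exact: cu|exact: cx|exact: cv|exact: cy].
split=> [t|t].
  apply: (cvgD _ (ct t)).
  exact: (@continuous_comp R R R q atan t (cq t) (@continuous_atan R (q t))).
have [r r0 e] := ratio_argP (zw t); have [r' r0' e'] := face_point t.
exists (r * r'); first exact: mulr_gt0.
by rewrite [LHS]e [X in _ * X = _]e' cisD rmorphM; ring.
Qed.

(* Loops on [a, b] are extended to the whole line by clamping the parameter, so
   that continuity never has to be relativized to an interval. *)
Definition clamp a b t := Num.max a (Num.min b t).

Lemma clamp_itv a b t : a <= b -> a <= clamp a b t <= b.
Proof.
by move=> ab; rewrite /clamp le_max lexx/= ge_max ab ge_min lexx.
Qed.

Lemma clamp_id a b t : a <= t <= b -> clamp a b t = t.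
Proof.
by move=> /andP[a1 b1]; rewrite /clamp (min_idPr b1) (max_idPr a1).
Qed.

Lemma continuous_clamp a b : continuous (clamp a b).
Proof.
move=> t; rewrite /clamp; apply: continuous_max; first exact: cvg_cst.
by apply: continuous_min; [exact: cvg_cst|exact: cvg_id].
Qed.

Lemma ccontinuous_comp (S T : topologicalType) (f : T -> R[i]) (g : S -> T) :
  continuous g -> ccontinuous f -> ccontinuous (f \o g).
Proof.
move=> cg [c1 c2]; split=> p.
  exact: (@continuous_comp S T R g (fun p => complex.Re (f p)) p (cg p) (c1 (g p))).
exact: (@continuous_comp S T R g (fun p => complex.Im (f p)) p (cg p) (c2 (g p))).
Qed.

Lemma ccontinuousB (T : topologicalType) (f g : T -> R[i]) :
  ccontinuous f -> ccontinuous g -> ccontinuous (fun p => f p - g p).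
Proof.
move=> [f1 f2] [g1 g2]; split.
  rewrite (_ : (fun p => _) = (fun p => complex.Re (f p) - complex.Re (g p))).
    by move=> p; apply: cvgB; [exact: f1|exact: g1].
  by apply/funext => r; case: (f r) (g r) => ? ? [].
rewrite (_ : (fun p => _) = (fun p => complex.Im (f p) - complex.Im (g p))).
  by move=> p; apply: cvgB; [exact: f2|exact: g2].
by apply/funext => r; case: (f r) (g r) => ? ? [].
Qed.

Lemma ccontinuous_sqn (T : topologicalType) (f : T -> R[i]) :
  ccontinuous f -> continuous (sqn \o f).
Proof.
move=> [c1 c2] p; rewrite /sqn /=; apply: cvgD; rewrite /=.
  by under eq_fun do rewrite expr2; rewrite expr2; apply: cvgM; exact: c1.
by under eq_fun do rewrite expr2; rewrite expr2; apply: cvgM; exact: c2.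
Qed.

Definition has_turn z a b (k : R) :=
  exists2 theta, is_arg z theta & theta b - theta a = k.

Lemma has_turn_close z w a b k : ccontinuous z -> ccontinuous w ->
  (forall t, sqn (z t - w t) < sqn (z t)) -> z a = z b -> w a = w b ->
  has_turn z a b k -> has_turn w a b k.
Proof.
move=> cz cw zw za wa [th zth <-].
by have [th' ? ?] := is_arg_close cz cw zw za wa zth; exists th'.
Qed.

Lemma has_turn_unique z a b k k' : a <= b ->
  has_turn z a b k -> has_turn z a b k' -> k = k'.
Proof.
by move=> ab [th h <-] [th' h' <-]; exact: is_arg_unique ab h h'.
Qed.

(** * Homotopy invariance of the turn *)

Section Homotopy.
Variables (H : R * R -> R[i]) (a b : R).
Hypothesis ab : a <= b.
Hypothesis cH : ccontinuous H.
Hypothesis H0 : forall s t, H (s, t) != 0.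
Hypothesis Hclamp : forall s t, H (s, t) = H (s, clamp a b t).
Hypothesis Hab : forall s, H (s, a) = H (s, b).

Let cHs s : ccontinuous (fun t => H (s, t)).
Proof.
have c t : {for t, continuous (fun t => (s, t) : R * R)}.
  exact: (cvg_pair (cvg_cst s) cvg_id).
exact: (ccontinuous_comp c cH).
Qed.

(** Compactness of [[a, b]] makes the neighborhood of [s0] uniform in [t], and [Hclamp] extends this
    to the whole line. Both inequalities are recorded so that turns pass from [s0] to [s] and back:
    one gives an open set of parameters, the other an open complement. *)
Let near_close s0 : \forall s \near s0, forall t,
  sqn (H (s0, t) - H (s, t)) < sqn (H (s0, t)) /\
  sqn (H (s, t) - H (s0, t)) < sqn (H (s, t)).
Proof.
pose P s t := sqn (H (s0, t) - H (s, t)) < sqn (H (s0, t)) /\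
  sqn (H (s, t) - H (s0, t)) < sqn (H (s, t)).
suff : \near s0, `[a, b] `<=` P s0.
  apply: filterS => s h t.
  rewrite (Hclamp s0) (Hclamp s); apply: h => /=.
  by rewrite in_itv/= clamp_itv.
have /compact_near_coveringP nc := @segment_compact R a b.
apply: (nc R (nbhs s0) P) => t0 _.
have n0 : 0 < sqn (H (s0, t0)).
  have := H0 s0 t0; rewrite /sqn; case: (H _) => x y /= /eqP n.
  rewrite lt_def addr_ge0 ?sqr_ge0// andbT; apply/eqP => e; apply: n.
  by have [-> ->] : x = 0 /\ y = 0 by split; nra.
pose F (p : R * R) := H (s0, p.1).
pose G (p : R * R) := H (p.2, p.1).
have cF : ccontinuous F.
  apply: (@ccontinuous_comp _ _ (fun t => H (s0, t)) fst) (cHs s0).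
  by move=> p; exact: cvg_fst.
have cG : ccontinuous G.
  apply: (@ccontinuous_comp _ _ H (fun p => (p.2, p.1))) cH.
  by move=> p; exact: (cvg_pair cvg_snd cvg_fst).
have cD (F1 F2 : R * R -> R[i]) : ccontinuous F1 -> ccontinuous F2 ->
    continuous (fun p => sqn (F1 p) - sqn (F1 p - F2 p)).
  move=> c1 c2 p; apply: cvgB; first exact: ccontinuous_sqn.
  exact: ccontinuous_sqn (ccontinuousB c1 c2) p.
have sqn0 : sqn 0 = 0 by rewrite /sqn /= expr0n addr0.
have h1 : \forall p \near (t0, s0), 0 < sqn (F p) - sqn (F p - G p).
  have /cvgr_gt := cD F G cF cG (t0, s0); apply.
  by rewrite /F /G /= subrr sqn0 subr0.
have h2 : \forall p \near (t0, s0), 0 < sqn (G p) - sqn (G p - F p).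
  have /cvgr_gt := cD G F cG cF (t0, s0); apply.
  by rewrite /F /G /= subrr sqn0 subr0.
have : \forall p \near (t0, s0), P p.2 p.1.
  near=> p; split; rewrite -subr_gt0; [near: p; exact: h1|near: p; exact: h2].
by [].
Unshelve. all: by end_near. Qed.

(* The set of the s for which the loop H (s, _) has turn k is clopen. *)
Lemma homotopy_has_turn s0 s1 k :
  has_turn (fun t => H (s0, t)) a b k -> has_turn (fun t => H (s1, t)) a b k.
Proof.
move=> h0; pose A := [set s | has_turn (fun t => H (s, t)) a b k].
have loc s : \forall s' \near s, A s <-> A s'.
  apply: filterS (near_close s) => s' h.
  split.
    by apply: (has_turn_close (cHs s) (cHs s') _ (Hab s) (Hab s')) => t; exact: (h t).1.
  by apply: (has_turn_close (cHs s') (cHs s) _ (Hab s') (Hab s)) => t; exact: (h t).2.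
have oA : open A.
  by rewrite openE => s As; apply: filterS (loc s) => s' [+ _]; exact.
have cA : closed A.
  rewrite -openC openE => s As; apply: filterS (loc s) => s' [_ h] As'.
  by apply: As; exact: h.
have : connected [set: R] by apply/connected_intervalP => ? ? _ _ ? _.
move=> /(_ A) AT; suff : A s1 by [].
rewrite AT//; first by exists s0.
  by exists A => //; rewrite setTI.
by exists A => //; rewrite setTI.
Qed.

End Homotopy.
End Winding.

(** * Continuity of complex-valued maps, polar form and products of loops *)

Section ComplexTopology.
Context {R : realType}.
Local Open Scope complex_scope.
Implicit Types (z w : R[i]).

Lemma normcE2 z : ComplexField.Normc.normc z = Num.sqrt (sqn z).
Proof. by case: z. Qed.

Lemma sqn_normc z : sqn z = ComplexField.Normc.normc z ^+ 2.
Proof.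
rewrite normcE2 sqr_sqrtr// /sqn addr_ge0 ?sqr_ge0//.
Qed.

Lemma sqn_ge0 z : 0 <= sqn z.
Proof. by rewrite /sqn addr_ge0 ?sqr_ge0. Qed.

Lemma sqn_gt0 z : (0 < sqn z) = (z != 0).
Proof.
rewrite lt_def sqn_ge0 andbT; congr (~~ _); case: z => x y.
by rewrite /sqn /= paddr_eq0 ?sqr_ge0// !sqrf_eq0 eq_complex.
Qed.

Lemma normc_eq z : `|z| = (Num.sqrt (sqn z))%:C.
Proof. by rewrite normc_def. Qed.

Lemma gt0_complexP (e : R[i]) : 0 < e -> exists2 k : R, 0 < k & e = k%:C.
Proof.
rewrite ltcE; case: e => x y /= /andP[/eqP -> x0]; by exists x.
Qed.

Lemma Re_continuous : continuous (fun z : R[i]^o => complex.Re z : R).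
Proof.
move=> z; have FF : Filter (nbhs (z : R[i]^o)) by exact: nbhs_filter.
apply/cvgrPdist_lt => e e0.
have e0' : 0 < e%:C by rewrite ltcR.
have /cvgrPdist_lt/(_ _ e0') := @cvg_id _ (nbhs (z : R[i]^o)).
apply: filterS => w /= zw.
rewrite -ltcR; apply: le_lt_trans zw.
have := normc_ge_Re (z - w); apply: le_trans.
by rewrite lecR; case: (z) (w) => ? ? [].
Qed.

Lemma Im_continuous : continuous (fun z : R[i]^o => complex.Im z : R).
Proof.
move=> z; have FF : Filter (nbhs (z : R[i]^o)) by exact: nbhs_filter.
apply/cvgrPdist_lt => e e0.
have e0' : 0 < e%:C by rewrite ltcR.
have /cvgrPdist_lt/(_ _ e0') := @cvg_id _ (nbhs (z : R[i]^o)).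
apply: filterS => w /= zw.
rewrite -ltcR; apply: le_lt_trans zw.
rewrite normc_eq lecR -sqrtr_sqr; apply: ler_wsqrtr.
by rewrite /sqn; case: (z) (w) => ? ? [] ? ? /=; rewrite lerDr sqr_ge0.
Qed.

Lemma continuous_ccontinuous (T : topologicalType) (f : T -> R[i]^o) :
  continuous f -> ccontinuous f.
Proof.
move=> cf; split=> p.
  exact: (@continuous_comp T R[i]^o R f _ p (cf p) (@Re_continuous (f p))).
exact: (@continuous_comp T R[i]^o R f _ p (cf p) (@Im_continuous (f p))).
Qed.

Lemma ccontinuous_continuous (T : topologicalType) (f : T -> R[i]^o) :
  ccontinuous f -> continuous f.
Proof.
move=> [c1 c2] p; apply/cvgrPdist_lt => _ /gt0_complexP[k k0 ->].
have k2 : 0 < k / 2 by rewrite divr_gt0.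
have /cvgrPdist_lt/(_ _ k2) h1 := c1 p.
have /cvgrPdist_lt/(_ _ k2) h2 := c2 p.
near=> q.
have a1 : `|complex.Re (f p) - complex.Re (f q)| < k / 2 by near: q.
have a2 : `|complex.Im (f p) - complex.Im (f q)| < k / 2 by near: q.
rewrite normc_eq ltcR -[ltRHS](ger0_norm (ltW k0)) -sqrtr_sqr ltr_sqrt ?exprn_gt0//.
move: a1 a2; rewrite /sqn; case: (f p) (f q) => x y [u v] /=.
rewrite !ltr_norml => /andP[a1 a2] /andP[a3 a4].
have h3 : (x - u) ^+ 2 < (k / 2) ^+ 2 by clear -a1 a2 k0; nra.
have h4 : (y - v) ^+ 2 < (k / 2) ^+ 2 by clear -a3 a4 k0; nra.
by clear -h3 h4 k0; nra.
Unshelve. all: by end_near. Qed.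

(** Relative continuity becomes plain continuity after composition with a map into the subset; the
    clamped loops and homotopies below are such maps. *)
Lemma within_comp_continuous (S T U : topologicalType) (A : set T) (f : T -> U)
    (phi : S -> T) :
  {within A, continuous f} -> continuous phi -> (forall p, A (phi p)) ->
  continuous (f \o phi).
Proof.
move=> cf cphi Aphi p.
move/subspace_continuousP : cf => /(_ _ (Aphi p)) cf.
apply: cvg_comp cf.
move=> W; rewrite /within /= => /(cphi p) Wp.
have : nbhs p (fun q => A (phi q) -> W (phi q)) by exact: Wp.
by apply: filterS => q; apply.
Qed.

Lemma ptws_continuous (T : topologicalType) (V : choiceType)
    (phi : T -> {ptws V -> R}) :
  (forall v, continuous (fun p => phi p v)) -> continuous phi.
Proof.
move=> cphi p; apply/cvg_sup => v U [B [[W oW <-] Wphi BU]].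
apply: filterS BU _; apply: (cphi v p); exact: open_nbhs_nbhs.
Qed.

Lemma ptws_eval_continuous (V : choiceType) (v : V) :
  continuous (fun x : {ptws V -> R} => x v).
Proof. exact: (@proj_continuous V (fun=> R) v). Qed.

Lemma polar z : z != 0 -> exists2 rho, 0 < rho & exists t, z = rho%:C * cis t.
Proof.
rewrite -sqn_gt0 => z0; pose rho := Num.sqrt (sqn z).
have r0 : 0 < rho by rewrite sqrtr_gt0.
have r2 : rho ^+ 2 = sqn z by rewrite sqr_sqrtr ?ltW.
exists rho => //; move: z0 r2; clearbody rho; rewrite /sqn; case: z => x y /= z0 r2.
have rn : rho != 0 by rewrite gt_eqF.
have x1 : -1 <= x / rho <= 1.
  by rewrite ler_pdivrMr// ler_pdivlMr//; apply/andP; split; nra.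
have sq : Num.sqrt (1 - (x / rho) ^+ 2) = `|y| / rho.
  have -> : 1 - (x / rho) ^+ 2 = (y / rho) ^+ 2.
    have -> : 1 = (x ^+ 2 + y ^+ 2) / rho ^+ 2.
      by rewrite -r2 divff// expf_neq0.
    by field.
  by rewrite sqrtr_sqr normrM normfV (gtr0_norm r0).
have [y0|y0] := leP 0 y.
  exists (acos (x / rho)); rewrite /cis acosK ?in_itv//= sin_acos// sq ger0_norm//.
  by simpc; congr (_ +i* _); field.
exists (- acos (x / rho)); rewrite /cis cosN sinN acosK ?in_itv//= sin_acos// sq ltr0_norm//.
by simpc; congr (_ +i* _); field.
Qed.

Lemma has_turn_cst z (a b : R) : z != 0 -> has_turn (fun=> z) a b 0.
Proof.
move=> /polar[rho r0 [t zt]]; exists (fun=> t); last by rewrite subrr.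
by split=> [p|p]; [exact: cvg_cst|exists rho].
Qed.

Lemma has_turnM (f g : R -> R[i]) (a b k k' : R) :
  has_turn f a b k -> has_turn g a b k' ->
  has_turn (fun t => f t * g t) a b (k + k').
Proof.
move=> [th fth <-] [th' gth' <-]; exists (fun t => th t + th' t).
  exact: is_argM.
by lra.
Qed.

Lemma ccontinuous_cst (T : topologicalType) z : ccontinuous (fun _ : T => z).
Proof. by split=> p; exact: cvg_cst. Qed.

Lemma ccontinuousM (T : topologicalType) (f g : T -> R[i]) :
  ccontinuous f -> ccontinuous g -> ccontinuous (fun p => f p * g p).
Proof.
move=> [f1 f2] [g1 g2]; split.
  rewrite (_ : (fun p => _) = (fun p => complex.Re (f p) * complex.Re (g p) -
      complex.Im (f p) * complex.Im (g p))).
    by move=> p; apply: cvgB; apply: cvgM;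
      [exact: f1|exact: g1|exact: f2|exact: g2].
  by apply/funext => r; case: (f r) (g r) => ? ? [].
rewrite (_ : (fun p => _) = (fun p => complex.Re (f p) * complex.Im (g p) +
    complex.Im (f p) * complex.Re (g p))).
  by move=> p; apply: cvgD; apply: cvgM;
    [exact: f1|exact: g2|exact: f2|exact: g1].
by apply/funext => r; case: (f r) (g r) => ? ? [].
Qed.

End ComplexTopology.

(** * Barycentric coordinates and boundaries of faces *)

Section Simplex.
Context {R : realType} {V : choiceType}.
Implicit Types (K : complex2 V).

Definition face_point (u v w : V) (a b c : R) : {ptws V -> R} :=
  fun z => a * (z == u)%:R + b * (z == v)%:R + c * (z == w)%:R.

Lemma face_distinct K u v w : K u v w -> [/\ u != v, v != w & w != u].
Proof.
move=> F; split; apply/eqP; apply: face_neq; first exact: F.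
  exact: face_rot F.
exact: face_rot (face_rot F).
Qed.

Lemma face_point1 K u v w a b c : K u v w -> face_point u v w a b c u = a.
Proof.
move=> /face_distinct[/negPf uv _ /negPf wu].
by rewrite /face_point eqxx uv (eq_sym u w) wu /= !mulr0 !addr0 mulr1.
Qed.

Lemma face_point2 K u v w a b c : K u v w -> face_point u v w a b c v = b.
Proof.
move=> /face_distinct[/negPf uv /negPf vw _].
by rewrite /face_point eqxx (eq_sym v u) uv vw /= !mulr0 addr0 add0r mulr1.
Qed.

Lemma face_point3 K u v w a b c : K u v w -> face_point u v w a b c w = c.
Proof.
move=> /face_distinct[_ /negPf vw /negPf wu].
by rewrite /face_point eqxx (eq_sym w v) vw wu /= !mulr0 !add0r mulr1.
Qed.

Lemma face_point_out u v w a b c z : z != u -> z != v -> z != w -> face_point u v w a b c z = 0.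
Proof.
by move=> /negPf h1 /negPf h2 /negPf h3; rewrite /face_point h1 h2 h3 !mulr0 !addr0.
Qed.

Lemma face_point_realization K u v w a b c : K u v w ->
  0 <= a -> 0 <= b -> 0 <= c -> a + b + c = 1 -> realization K (face_point u v w a b c).
Proof.
move=> F a0 b0 c0 abc; exists u, v, w; split => //.
- by move=> z; rewrite /face_point !addr_ge0// mulr_ge0// ler0n.
- by move=> z /eqP zu /eqP zv /eqP zw; rewrite face_point_out.
- by rewrite (face_point1 _ _ _ F) (face_point2 _ _ _ F) (face_point3 _ _ _ F).
Qed.

Lemma face_point_continuous (T : topologicalType) u v w (a b c : T -> R) :
  continuous a -> continuous b -> continuous c ->
  continuous (fun p => face_point u v w (a p) (b p) (c p)).
Proof.
move=> ca cb cc; apply: ptws_continuous => z p; rewrite /face_point.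
apply: cvgD; first apply: cvgD; apply: cvgM; try exact: cvg_cst.
- exact: ca.
- exact: cb.
- exact: cc.
Qed.

(** The coordinates of [face_boundary] on [0, 3], written with maxima and absolute values so that
    continuity needs no gluing of the three pieces. *)
Definition boundary1 (t : R) := Num.max 0 (Num.max (1 - t) (t - 2)).
Definition boundary2 (t : R) := Num.max 0 (1 - `|t - 1|).
Definition boundary3 (t : R) := Num.max 0 (1 - `|t - 2|).

Lemma boundary1_continuous : continuous boundary1.
Proof.
have c1 : continuous (fun t : R => 1 - t).
  by move=> t; apply: cvgB; [exact: cvg_cst|exact: cvg_id].
have c2 : continuous (fun t : R => t - 2).
  by move=> t; apply: cvgB; [exact: cvg_id|exact: cvg_cst].
move=> t; exact: (continuous_max (cvg_cst 0) (continuous_max (c1 t) (c2 t))).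
Qed.

Let hat_continuous (c : R) : continuous (fun t : R => Num.max 0 (1 - `|t - c|)).
Proof.
have c1 : continuous (fun t : R => 1 - `|t - c|).
  move=> t; apply: cvgB; first exact: cvg_cst.
  by apply: cvg_norm; apply: cvgB; [exact: cvg_id|exact: cvg_cst].
move=> t; exact: (continuous_max (cvg_cst 0) (c1 t)).
Qed.

Lemma boundary2_continuous : continuous boundary2.
Proof. exact: hat_continuous. Qed.

Lemma boundary3_continuous : continuous boundary3.
Proof. exact: hat_continuous. Qed.

Lemma boundaryE (t : R) : 0 <= t <= 3 ->
  [\/ [/\ t <= 1, boundary1 t = 1 - t, boundary2 t = t & boundary3 t = 0],
      [/\ 1 < t <= 2, boundary1 t = 0, boundary2 t = 2 - t & boundary3 t = t - 1] |
      [/\ 2 < t, boundary1 t = t - 2, boundary2 t = 0 & boundary3 t = 3 - t]].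
Proof.
move=> /andP[t0 t3].
have M (x y : R) : (x <= y -> Num.max x y = y) * (y <= x -> Num.max x y = x).
  by split; [exact: max_r|exact: max_l].
have [t1|t1] := leP t 1.
  apply: Or31; split => //; rewrite /boundary1 /boundary2 /boundary3.
  - by rewrite (max_l (y := t - 2)) ?max_r//; lra.
  - by rewrite ler0_norm ?max_r; lra.
  - by rewrite ler0_norm ?max_l; lra.
have [t2|t2] := leP t 2.
  apply: Or32; split => //; rewrite /boundary1 /boundary2 /boundary3.
  - by rewrite max_l// ge_max; lra.
  - by rewrite ger0_norm ?max_r; lra.
  - by rewrite ler0_norm ?max_r; lra.
apply: Or33; split => //; rewrite /boundary1 /boundary2 /boundary3.
- by rewrite (max_r (x := 1 - t)) ?max_r//; lra.
- by rewrite ger0_norm ?max_l; lra.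
- by rewrite ger0_norm ?max_r; lra.
Qed.

Lemma face_boundaryE u v w (t : R) : 0 <= t <= 3 ->
  face_boundary u v w t = face_point u v w (boundary1 t) (boundary2 t) (boundary3 t).
Proof.
move=> t03; apply/funext => z; rewrite /face_boundary /face_point /segment /vertex.
case: (boundaryE t03) => -[h -> -> ->].
- by rewrite h; ring.
- by case/andP: h => h1 h2; rewrite leNgt h1/= h2; ring.
- rewrite !leNgt h (lt_trans _ h) ?ltr1n//=; ring.
Qed.

Lemma boundary_ge0 (t : R) : [/\ 0 <= boundary1 t, 0 <= boundary2 t & 0 <= boundary3 t].
Proof. by split; rewrite le_max lexx. Qed.

Lemma boundary_sum (t : R) : 0 <= t <= 3 -> boundary1 t + boundary2 t + boundary3 t = 1.
Proof. by case/boundaryE => -[_ -> -> ->]; lra. Qed.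

End Simplex.

(** * The two sides of an edge of a plane triangulation *)

(** Each of [a * (2 * e)] and [b * (2 * e)] is at most [a * b / 4], and 1/2 < 49/64. Here [a], [b]
    stand for distances from two loops to the middle of an edge, and [e] for the distance from that
    middle to the base points. *)
Lemma leash_bound (R : realType) (a b e : R) : 0 < e -> 8 * e <= a -> 8 * e <= b ->
  (a + b) * (2 * e) < 7 / 8 * a * (7 / 8 * b).
Proof. nra. Qed.

Section Surface.
Context {R : realType} {V : choiceType}.
Local Open Scope complex_scope.
Variables (K : complex2 V) (D : set R[i]^o) (h : {ptws V -> R} -> R[i]^o).
Variable g : R[i]^o -> {ptws V -> R}.
Hypothesis openD : open D.
Hypothesis contin_h : {within realization K, continuous h}.
Hypothesis contin_g : {within D, continuous g}.
Hypothesis hK : forall x, realization K x -> D (h x) /\ g (h x) = x.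
Hypothesis gK : forall z, D z -> realization K (g z) /\ h (g z) = z.
Hypothesis winds : forall u v w, K u v w -> forall x : V -> R,
  realization K x -> 0 < x u -> 0 < x v -> 0 < x w ->
  winds_once (fun t => h (face_boundary u v w t)) (h x).

Let h_inj x y : realization K x -> realization K y -> h x = h y -> x = y.
Proof. by move=> /hK[_ e1] /hK[_ e2] e; rewrite -e1 e e2. Qed.

Let h_comp (T : topologicalType) (phi : T -> {ptws V -> R}) :
  continuous phi -> (forall p, realization K (phi p)) ->
  ccontinuous (fun p => h (phi p)).
Proof.
move=> cphi Kphi; apply: continuous_ccontinuous.
exact: (within_comp_continuous contin_h cphi Kphi).
Qed.

Definition face_loop u v w (t : R) : {ptws V -> R} :=
  face_boundary u v w (clamp 0 3 t).

Let in03 (t : R) : 0 <= clamp 0 3 t <= 3.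
Proof. by apply: clamp_itv; rewrite ler0n. Qed.

Let in01 (t : R) : 0 <= clamp 0 1 t <= 1.
Proof. by apply: clamp_itv; rewrite ler01. Qed.

Let loopE u v w t : face_loop u v w t =
  face_point u v w (boundary1 (clamp 0 3 t)) (boundary2 (clamp 0 3 t)) (boundary3 (clamp 0 3 t)).
Proof. by rewrite /face_loop face_boundaryE. Qed.

Let loop_realization u v w t : K u v w -> realization K (face_loop u v w t).
Proof.
move=> F; rewrite loopE; have [b1 b2 b3] := boundary_ge0 (clamp 0 3 t).
by apply: face_point_realization => //; exact: boundary_sum.
Qed.

Let continuous_comp' (T U W : topologicalType) (f : T -> U) (k : U -> W) :
  continuous f -> continuous k -> continuous (fun p => k (f p)).
Proof. by move=> cf ck p; exact: (continuous_comp (cf p) (ck (f p))). Qed.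

Let loop_continuous u v w : continuous (face_loop u v w).
Proof.
rewrite (_ : face_loop u v w = fun t => face_point u v w (boundary1 (clamp 0 3 t))
  (boundary2 (clamp 0 3 t)) (boundary3 (clamp 0 3 t))); last first.
  by apply/funext => t; exact: loopE.
apply: face_point_continuous.
- exact: (continuous_comp' (@continuous_clamp R 0 3) boundary1_continuous).
- exact: (continuous_comp' (@continuous_clamp R 0 3) boundary2_continuous).
- exact: (continuous_comp' (@continuous_clamp R 0 3) boundary3_continuous).
Qed.

Let loop_ccontinuous u v w : K u v w -> ccontinuous (fun t => h (face_loop u v w t)).
Proof.
by move=> F; apply: h_comp; [exact: loop_continuous|move=> t; exact: loop_realization].
Qed.

Let loop03 u v w : face_loop u v w 0 = face_loop u v w 3.
Proof.
rewrite /face_loop !clamp_id ?lexx ?ler0n//.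
rewrite !face_boundaryE ?lexx ?ler0n//.
have h0 : 0 <= (0 : R) <= 3 by lra.
have h3 : 0 <= (3 : R) <= 3 by lra.
case: (boundaryE h0) => -[k0 -> -> ->]; [|by exfalso; lra|by exfalso; lra].
case: (boundaryE h3) => -[k3 -> -> ->]; [by exfalso; lra|by exfalso; lra|].
by apply/funext => z; rewrite /face_point; ring.
Qed.

Definition clamped_segment (x y : {ptws V -> R}) (s : R) : {ptws V -> R} :=
  segment x y (clamp 0 1 s).

Let segm_realization u v w (x y : {ptws V -> R}) s : K u v w ->
  (forall z, 0 <= x z) -> (forall z, z <> u -> z <> v -> z <> w -> x z = 0) ->
  x u + x v + x w = 1 ->
  (forall z, 0 <= y z) -> (forall z, z <> u -> z <> v -> z <> w -> y z = 0) ->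
  y u + y v + y w = 1 -> realization K (clamped_segment x y s).
Proof.
move=> F x0 xn xs y0 yn ys; have /andP[s0 s1] := in01 s.
exists u, v, w; split => //; rewrite /clamped_segment /segment.
- by move=> z; rewrite addr_ge0// mulr_ge0// subr_ge0.
- by move=> z zu zv zw; rewrite xn// yn// !mulr0 addr0.
- by move: xs ys; set a := clamp _ _ _; nra.
Qed.

Let segm_continuous (T : topologicalType) (x y : T -> {ptws V -> R}) (s : T -> R) :
  continuous x -> continuous y -> continuous s ->
  continuous (fun p => clamped_segment (x p) (y p) (s p)).
Proof.
move=> cx cy cs; apply: ptws_continuous => z.
have cs' := continuous_comp' cs (@continuous_clamp R 0 1).
have cxz := continuous_comp' cx (@ptws_eval_continuous R V z).
have cyz := continuous_comp' cy (@ptws_eval_continuous R V z).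
move=> p; rewrite /clamped_segment /segment; apply: cvgD; apply: cvgM.
- by apply: cvgB; [exact: cvg_cst|exact: cs'].
- exact: cxz.
- exact: cs'.
- exact: cyz.
Qed.

Let segm0 x y : clamped_segment x y 0 = x.
Proof.
by apply/funext => z; rewrite /clamped_segment /segment clamp_id ?lexx ?ler01//; ring.
Qed.

Let segm1 x y : clamped_segment x y 1 = y.
Proof.
by apply/funext => z; rewrite /clamped_segment /segment clamp_id ?lexx ?ler01//; ring.
Qed.

Let ptE u v w (x : {ptws V -> R}) : K u v w ->
  (forall z, z <> u -> z <> v -> z <> w -> x z = 0) ->
  x = face_point u v w (x u) (x v) (x w).
Proof.
move=> F x0; apply/funext => z.
have [->|zu] := eqVneq z u; first by rewrite (face_point1 _ _ _ F).
have [->|zv] := eqVneq z v; first by rewrite (face_point2 _ _ _ F).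
have [->|zw] := eqVneq z w; first by rewrite (face_point3 _ _ _ F).
by rewrite face_point_out// x0//; exact/eqP.
Qed.

Let B0 : (0:R) <= 3. Proof. by rewrite ler0n. Qed.

(* The loop contracts in the closed face, to which x does not belong. *)
Let loop_turn0 u v w x : K u v w -> realization K x ->
  (forall a b c, x <> face_point u v w a b c) ->
  has_turn (fun t => h (face_loop u v w t) - h x) 0 3 0.
Proof.
move=> F Kx xF.
pose L t := face_loop u v w t.
pose H (p : R * R) := h (clamped_segment (L 0) (L p.2) p.1) - h x.
have Lout t z : z <> u -> z <> v -> z <> w -> L t z = 0.
  by move=> /eqP ? /eqP ? /eqP ?; rewrite /L loopE face_point_out.
have Lge0 t z : 0 <= L t z.
  rewrite /L loopE /face_point; have [? ? ?] := boundary_ge0 (clamp 0 3 t).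
  by rewrite !addr_ge0// mulr_ge0// ler0n.
have Lsum t : L t u + L t v + L t w = 1.
  rewrite /L loopE (face_point1 _ _ _ F) (face_point2 _ _ _ F) (face_point3 _ _ _ F).
  exact: boundary_sum.
have KH s t : realization K (clamped_segment (L 0) (L t) s).
  exact: (segm_realization s F (Lge0 0) (Lout 0) (Lsum 0) (Lge0 t) (Lout t) (Lsum t)).
have cH : ccontinuous H.
  apply: ccontinuousB; last exact: ccontinuous_cst.
  apply: h_comp => [|p]; last exact: KH.
  apply: segm_continuous; first by move=> p; exact: cvg_cst.
    have c2 : continuous (@snd R R) by move=> p; exact: cvg_snd.
    exact: (continuous_comp' c2 (@loop_continuous u v w)).
  by move=> p; exact: cvg_fst.
have H0 s t : H (s, t) != 0.
  rewrite /H subr_eq0; apply/eqP => /h_inj e.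
  have {}e := e (KH s t) Kx.
  apply: (xF (x u) (x v) (x w)); apply: ptE => //.
  move=> z zu zv zw; rewrite -e /clamped_segment /segment /= !Lout// !mulr0 addr0//.
have Hc s t : H (s, t) = H (s, clamp 0 3 t).
  by rewrite /H /L /face_loop /= (clamp_id (t := clamp 0 3 t)).
have Hab s : H (s, 0) = H (s, 3) by rewrite /H /L /= loop03.
have t0 : has_turn (fun t => H (0, t)) 0 3 0.
  rewrite (_ : (fun t => _) = fun=> H (0, 0)); last first.
    by apply/funext => t; rewrite /H /= !segm0.
  exact: has_turn_cst.
have := @homotopy_has_turn R H 0 3 B0 cH H0 Hc Hab 0 1 0 t0.
by rewrite /H /=; under [X in has_turn X]eq_fun do rewrite segm1.
Qed.

Let loop_turn1 u v w a b c : K u v w -> 0 < a -> 0 < b -> 0 < c ->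
  a + b + c = 1 ->
  has_turn (fun t => h (face_loop u v w t) - h (face_point u v w a b c)) 0 3 (2 * pi).
Proof.
move=> F a0 b0 c0 abc.
have Kx : realization K (face_point u v w a b c).
  by apply: face_point_realization => //; exact: ltW.
have := winds F Kx; rewrite (face_point1 _ _ _ F) (face_point2 _ _ _ F) (face_point3 _ _ _ F).
move=> /(_ a0 b0 c0)[th [cth pth thE]].
exists (fun t => th (clamp 0 3 t)); last by rewrite !clamp_id ?lexx ?ler0n.
split.
  apply: (within_comp_continuous cth (@continuous_clamp R 0 3)) => t.
  by rewrite /= in_itv/=; exact: in03.
move=> t; have [n0 e] := pth _ (in03 t).
exists (ComplexField.Normc.normc (h (face_loop u v w t) - h (face_point u v w a b c))).
  by rewrite normcE2 sqrtr_gt0 sqn_gt0 subr_eq0; exact/eqP.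
exact: e.
Qed.

(** The point slides along the median from [w] to the middle of [uv]; [0 < s < 1] keeps it inside
    the open face, where the orientation hypothesis applies. *)
Let point_near u v w : K u v w -> forall e : R, 0 < e ->
  exists s, [/\ 0 < s, s < 1 &
  sqn (h (face_point u v w ((1 - s) / 2) ((1 - s) / 2) s) - h (face_point u v w 2^-1 2^-1 0)) < e].
Proof.
move=> F e e0.
pose x (s : R) := face_point u v w ((1 - clamp 0 1 s) / 2) ((1 - clamp 0 1 s) / 2) (clamp 0 1 s).
have x0 : x 0 = face_point u v w 2^-1 2^-1 0.
  by rewrite /x clamp_id ?lexx ?ler01// subr0 mul1r.
have cx : continuous x.
  have c1 : continuous (fun s : R => (1 - clamp 0 1 s) / 2).
    move=> s; apply: cvgM; last exact: cvg_cst.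
    by apply: cvgB; [exact: cvg_cst|exact: continuous_clamp].
  by apply: face_point_continuous => //; exact: continuous_clamp.
have Kx s : realization K (x s).
  have /andP[s0 s1] := in01 s.
  by apply: face_point_realization => //; lra.
have cf : continuous (fun s => sqn (h (x s) - h (x 0))).
  apply: (ccontinuous_sqn (f := fun s => h (x s) - h (x 0))).
  by apply: ccontinuousB; [exact: h_comp|exact: ccontinuous_cst].
have /cvgr_lt := cf 0; rewrite subrr /sqn /= expr0n addr0 => /(_ _ e0) n0.
have : \forall s \near 0^'+, sqn (h (x s) - h (x 0)) < e.
  by apply: (@cvg_within _ (nbhs (0:R))); exact: n0.
move=> n0'.
have [s [s0 s1 sn]] : exists s, [/\ 0 < s, s < 1 & sqn (h (x s) - h (x 0)) < e].
  near (0:R)^'+ => s; exists s; split; near: s => //.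
    exact: nbhs_right_gt.
  by apply: nbhs_right_lt; exact: ltr01.
exists s; split => //; rewrite -x0.
by move: sn; rewrite /x clamp_id// !ltW.
Unshelve. all: by end_near. Qed.

(** For parameters in [1, 3] the boundary runs along the edges [vw] and [wu], which miss the middle
    of [uv]; the distance attains a positive minimum there. *)
Let loop_away u v w : K u v w -> exists2 eta, 0 < eta & forall t, 1 <= t <= 3 ->
  eta <= ComplexField.Normc.normc (h (face_loop u v w t) - h (face_point u v w 2^-1 2^-1 0)).
Proof.
move=> F; set m := h _.
pose f t := sqn (h (face_loop u v w t) - m).
have cf : continuous f.
  apply: (ccontinuous_sqn (f := fun t => h (face_loop u v w t) - m)).
  by apply: ccontinuousB; [exact: loop_ccontinuous|exact: ccontinuous_cst].
have [|c c13 fc] := @EVT_min R f 1 3 _ (continuous_subspaceT cf).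
  by rewrite ler1n.
exists (Num.sqrt (f c)).
  rewrite sqrtr_gt0 sqn_gt0 subr_eq0; apply/eqP => /h_inj e.
  have {}e : face_loop u v w c = face_point u v w 2^-1 2^-1 0.
    by apply: e; [exact: loop_realization|apply: face_point_realization => //; lra].
  move: c13; rewrite in_itv/= => /andP[c1 c3].
  have c03 : 0 <= c <= 3 by lra.
  have e1 := congr1 (fun x : {ptws V -> R} => x u) e.
  have e2 := congr1 (fun x : {ptws V -> R} => x v) e.
  move: e1 e2; rewrite loopE clamp_id// !(face_point1 _ _ _ F) !(face_point2 _ _ _ F).
  by case: (boundaryE c03) => -[k1 -> -> _]; lra.
move=> t t13; rewrite normcE2; apply: ler_wsqrtr; apply: fc.
by rewrite in_itv.
Qed.

(* If the loops gamma and gamma' bound two faces on the same side of the edge uv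
   and z, z' are points of these faces near the middle of the edge, the loops
   (gamma - z) (gamma' - z') and (gamma - z') (gamma' - z) have turns 4 pi and 0;
   but they agree on the common edge and are close to each other elsewhere. *)
Lemma face_unique u v w w' : K u v w -> K u v w' -> w = w'.
Proof.
move=> F F'; apply/eqP; apply/negPn/negP => /eqP ww'.
pose m := h (face_point u v w 2^-1 2^-1 0).
have mE : m = h (face_point u v w' 2^-1 2^-1 0).
  by congr h; apply/funext => z; rewrite /face_point; ring.
have [eta eta0 away] := loop_away F.
have [eta' eta0' away'] := loop_away F'.
pose e := Num.min eta eta' / 8.
have e0 : 0 < e by rewrite divr_gt0 ?ltr0n// lt_min eta0.
have e1 : 8 * e <= eta by rewrite mulrC divfK ?pnatr_eq0// ge_min lexx.
have e1' : 8 * e <= eta' by rewrite mulrC divfK ?pnatr_eq0// ge_min lexx orbT.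
have e2 : 0 < e ^+ 2 by rewrite exprn_gt0.
have [s [s0 s1 sn]] := point_near F e2.
have [s' [s0' s1' sn']] := point_near F' e2.
set x := face_point _ _ _ _ _ _ in sn; set x' := face_point u v w' _ _ s' in sn'.
pose z := h x; pose z' := h x'.
have h1 : 0 < (1 - s) / 2 by lra.
have h1' : 0 < (1 - s') / 2 by lra.
have Kx : realization K x by apply: face_point_realization => //; lra.
have Kx' : realization K x' by apply: face_point_realization => //; lra.
have xw : x w = s by rewrite /x (face_point3 _ _ _ F).
have xw' : x' w' = s' by rewrite /x' (face_point3 _ _ _ F').
have turn1 : has_turn (fun t => h (face_loop u v w t) - z) 0 3 (2 * pi).
  by apply: loop_turn1 => //; lra.
have turn1' : has_turn (fun t => h (face_loop u v w' t) - z') 0 3 (2 * pi).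
  by apply: loop_turn1 => //; lra.
have [uv vw wu] := face_distinct F; have [_ vw' wu'] := face_distinct F'.
have turn0 : has_turn (fun t => h (face_loop u v w t) - z') 0 3 0.
  apply: loop_turn0 => // a b c xe; move: xw'; rewrite xe face_point_out //; first by lra.
    by rewrite eq_sym.
  by apply/eqP => wE; apply: ww'.
have turn0' : has_turn (fun t => h (face_loop u v w' t) - z) 0 3 0.
  apply: loop_turn0 => // a b c xe; move: xw; rewrite xe face_point_out //; first by lra.
    by rewrite eq_sym.
  exact/eqP.
have T1 := has_turnM turn1 turn1'.
have T0 := has_turnM turn0 turn0'.
suff T1' : has_turn (fun t => (h (face_loop u v w t) - z') * (h (face_loop u v w' t) - z))
    0 3 (2 * pi + 2 * pi).
  by have := has_turn_unique B0 T1' T0; have := pi_gt0 R; lra.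
have cc u1 v1 w1 z1 : K u1 v1 w1 -> ccontinuous (fun t => h (face_loop u1 v1 w1 t) - z1).
  move=> F1; apply: ccontinuousB; first exact: loop_ccontinuous.
  exact: ccontinuous_cst.
apply: has_turn_close T1; rewrite ?loop03//.
- by apply: ccontinuousM; exact: cc.
- by apply: ccontinuousM; exact: cc.
have n0 u1 v1 w1 t z1 k : has_turn (fun t => h (face_loop u1 v1 w1 t) - z1) 0 3 k ->
    0 < sqn (h (face_loop u1 v1 w1 t) - z1).
  move=> [th [_ /(_ t)[rho rho0 ->]] _]; rewrite sqn_gt0 mulf_neq0//.
    by apply: contraTneq rho0 => -[->]; rewrite ltxx.
  apply/eqP => -[c0 sn0]; have := cos2Dsin2 (th t); rewrite c0 sn0.
  by rewrite expr0n/= addr0; lra.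
have sqnM a b : sqn (a * b) = sqn a * sqn b :> R.
  by rewrite /sqn; case: a b => ? ? [] ? ? /=; ring.
(* The difference of the two products factors: the first factor vanishes on the common edge, and the
   second is at most [2 * e] in norm, which is the leash needed elsewhere. *)
move=> t; rewrite [X in sqn X < _](_ : _ =
  (h (face_loop u v w t) - h (face_loop u v w' t)) * (z - z')); last by ring.
rewrite [X in X < _]sqnM [X in _ < X]sqnM.
have [t1|t1] := leP (clamp 0 3 t) 1.
  have -> : face_loop u v w t = face_loop u v w' t by rewrite /face_loop /face_boundary t1.
  rewrite subrr {1}/sqn /= expr0n addr0 mul0r.
  have -> : face_loop u v w' t = face_loop u v w t by rewrite /face_loop /face_boundary t1.
  rewrite mulr_gt0//; first exact: n0 turn1.
  have -> : face_loop u v w t = face_loop u v w' t by rewrite /face_loop /face_boundary t1.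
  exact: n0 turn1'.
have t13 : 1 <= clamp 0 3 t <= 3.
  by rewrite ltW//=; have /andP[] := in03 t.
have lc u1 v1 w1 : face_loop u1 v1 w1 (clamp 0 3 t) = face_loop u1 v1 w1 t.
  by rewrite /face_loop (clamp_id (t := clamp 0 3 t)).
have := away _ t13; have := away' _ t13; rewrite -mE -/m !lc.
set G := h (face_loop u v w t); set G' := h (face_loop u v w' t) => b1 a1.
pose N (q : R[i]) := ComplexField.Normc.normc q.
have zm : N (z - m) < e.
  rewrite /N normcE2 -[ltRHS]gtr0_norm// -sqrtr_sqr ltr_sqrt//.
have zm' : N (z' - m) < e.
  rewrite /N normcE2 -[ltRHS]gtr0_norm// -sqrtr_sqr ltr_sqrt//.
  by rewrite mE.
have ND (p q r : R[i]) : N (p - q) <= N (p - r) + N (q - r).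
  rewrite /N -[X in _ <= _ + X]normcN opprB.
  by have := le_normcD (p - r) (r - q); rewrite addrA subrK.
have NB (p q : R[i]) : N (p - q) = N (q - p) by rewrite /N -normcN opprB.
have N0 (p : R[i]) : 0 <= N p by rewrite /N normcE2 sqrtr_ge0.
have d1 := ND G G' m.
have d2 := ND z z' m.
have d3 := ND G m z; have d3' := ND G' m z'.
rewrite [N (m - _)]NB in d3; rewrite [N (m - _)]NB in d3'.
rewrite !sqn_normc -!/(N _) -!exprMn.
rewrite ltrXn2r// ?mulr_ge0//.
rewrite -/(N _) in a1; rewrite -/(N _) in b1.
have A1 : N (G - z) >= 7 / 8 * N (G - m) by lra.
have A2 : N (G' - z') >= 7 / 8 * N (G' - m) by lra.
have A3 : N (z - z') <= 2 * e by lra.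
apply: (@le_lt_trans _ _ ((N (G - m) + N (G' - m)) * (2 * e))).
  by apply: ler_pM.
apply: (@lt_le_trans _ _ ((7 / 8 * N (G - m)) * (7 / 8 * N (G' - m)))).
  by apply: leash_bound => //; lra.
by apply: ler_pM => //; rewrite mulr_ge0// ?N0//; lra.
Qed.

(* Otherwise a small circle around the image of the middle of the edge uv lies in
   the image of the only face at this edge, where it can be contracted to the
   third vertex without meeting the middle of the edge. *)
Lemma face_opposite u v w : K u v w -> exists w', K v u w'.
Proof.
move=> F; apply: contrapT => /forallNP none.
pose mid : {ptws V -> R} := face_point u v w 2^-1 2^-1 0; pose m := h mid.
have [/negPf uv /negPf vw /negPf wu] := face_distinct F.
have Kmid : realization K mid by apply: face_point_realization => //; lra.
have [Dm gm] := hK Kmid.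
have near_g z0 : 0 < mid z0 -> \forall z \near (m : R[i]^o), D z -> 0 < g z z0.
  move=> p; have /subspace_continuousP/(_ _ Dm) cg := contin_g.
  have cz := cvg_comp _ _ cg (@ptws_eval_continuous R V z0 (g m)).
  have /cvgr_gt/(_ 0) := cz; rewrite gm => /(_ p).
  by [].
have [e e0 ball_e] : exists2 e : R, 0 < e & forall z : R[i]^o,
    sqn (z - m) = e ^+ 2 -> [/\ D z, 0 < g z u & 0 < g z v].
  have n1 : \forall z \near (m : R[i]^o), D z by exact: open_nbhs_nbhs.
  have n2 : \forall z \near (m : R[i]^o), D z -> 0 < g z u.
    by apply: near_g; rewrite /mid (face_point1 _ _ _ F); lra.
  have n3 : \forall z \near (m : R[i]^o), D z -> 0 < g z v.
    by apply: near_g; rewrite /mid (face_point2 _ _ _ F); lra.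
  have /nbhs_ballP[_ /gt0_complexP[k k0 ->] kP] :
      \forall z \near (m : R[i]^o), [/\ D z, 0 < g z u & 0 < g z v].
    near=> z; have Dz : D z by near: z.
    by split => //; move: Dz; near: z.
  exists (k / 2) => [|z ze]; first by rewrite divr_gt0.
  apply: kP; rewrite -ball_normE /= -normrN opprB normc_eq ze.
  rewrite sqrtr_sqr ltcR gtr0_norm ?divr_gt0//; lra.
(* A point of the circle has positive coordinates at [u] and [v], so its face contains both. The
   orientation [v u] is excluded by [none], and [face_unique] identifies the third vertex with
   [w]. *)
have n_face z : sqn (z - m) = e ^+ 2 ->
   [/\ forall y, 0 <= g z y, forall y, y <> u -> y <> v -> y <> w -> g z y = 0
     & g z u + g z v + g z w = 1].
  move=> /ball_e[Dz gu gv].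
  have [[a [b [c [F' g0 g_out gs]]]] _] := gK Dz.
  have mem y : 0 < g z y -> [\/ y = a, y = b | y = c].
    move=> gy; apply: contrapT => n; move: gy.
    by rewrite g_out ?ltxx// => ya; apply: n; rewrite ya; [apply: Or31|apply: Or32|apply: Or33].
  have [y [Fy gout gsum]] : exists y, [/\ K u v y,
      forall t, t <> u -> t <> v -> t <> y -> g z t = 0 & g z u + g z v + g z y = 1].
    case: (mem u gu) => eu; case: (mem v gv) => ev.
    - by move: uv; rewrite eu ev eqxx.
    - by exists c; split; [rewrite eu ev|move=> t; rewrite eu ev; exact: g_out|rewrite eu ev].
    - by case: (none b); rewrite eu ev; exact: face_rot (face_rot F').
    - by case: (none c); rewrite eu ev.
    - by move: uv; rewrite eu ev eqxx.
    - exists a; split; first by rewrite eu ev; exact: face_rot.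
        by move=> t; rewrite eu ev => tb tc ta; exact: g_out.
      by rewrite eu ev; lra.
    - exists b; split; first by rewrite eu ev; exact: face_rot (face_rot F').
        by move=> t; rewrite eu ev => tc ta tb; exact: g_out.
      by rewrite eu ev; lra.
    - by case: (none a); rewrite eu ev; exact: face_rot F'.
    - by move: uv; rewrite eu ev eqxx.
  by rewrite (face_unique F Fy).
pose th t : R := 2 * pi / 3 * clamp 0 3 t.
have cth : continuous th.
  by move=> t; apply: cvgM; [exact: cvg_cst|exact: continuous_clamp].
pose c t : R[i]^o := m - (- e)%:C * cis (th t).
have cc : continuous c.
  apply: ccontinuous_continuous.
  apply: ccontinuousB; first exact: ccontinuous_cst.
  apply: ccontinuousM; first exact: ccontinuous_cst.
  split; rewrite /cis /=; first exact: (continuous_comp' cth (@continuous_cos R)).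
  exact: (continuous_comp' cth (@continuous_sin R)).
have cm t : c t - m = e%:C * cis (th t) by rewrite /c rmorphN; ring.
have cme t : sqn (c t - m) = e ^+ 2.
  rewrite cm /cis /sqn; simpc; rewrite /= -[RHS]mulr1 -(cos2Dsin2 (th t)); ring.
have Dc t : D (c t) by have [] := ball_e _ (cme t).
pose G t := g (c t).
have cG : continuous G by exact: (within_comp_continuous contin_g cc Dc).
pose W : {ptws V -> R} := vertex w.
pose H (p : R * R) := h (clamped_segment (G p.2) W p.1) - m.
have KH s t : realization K (clamped_segment (G t) W s).
  have [g0 g_out gs] := n_face _ (cme t).
  apply: (segm_realization s F g0 g_out gs); rewrite /W /vertex.
  - by move=> z; rewrite ler0n.
  - by move=> z _ _ /eqP/negPf ->.
  - by rewrite eqxx eq_sym wu vw /= !add0r.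
have cH : ccontinuous H.
  apply: ccontinuousB; last exact: ccontinuous_cst.
  apply: h_comp => [|p]; last exact: KH.
  have c2 : continuous (@snd R R) by move=> p; exact: cvg_snd.
  apply: segm_continuous; first exact: (continuous_comp' c2 cG).
    by move=> p; exact: cvg_cst.
  by move=> p; exact: cvg_fst.
have H0 s t : H (s, t) != 0.
  rewrite /H subr_eq0; apply/eqP => /h_inj e'.
  have {}e' := e' (KH s t) Kmid.
  have [g0 g_out gs] := n_face _ (cme t).
  (* The [w]-coordinate is 0 at the middle of the edge and at least [clamp 0 1 s] on the segment, so
     the clamped parameter is 0 and the circle would pass through its own center. *)
  have := congr1 (fun x : {ptws V -> R} => x w) e'.
  rewrite /mid (face_point3 _ _ _ F) /clamped_segment /segment /W /vertex eqxx mulr1 /=.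
  move=> ew; have /andP[s0 s1] := in01 s.
  have p0 : 0 <= (1 - clamp 0 1 s) * G t w by rewrite mulr_ge0// ?subr_ge0//; exact: g0.
  have s0' : clamp 0 1 s = 0 by lra.
  move: e'; rewrite /clamped_segment s0' => e'.
  have GE : G t = mid.
    by rewrite -e'; apply/funext => z; rewrite /segment; ring.
  have := (gK (Dc t)).2; rewrite -/(G t) GE -/m => mc.
  by have := cme t; rewrite -mc subrr /sqn /= expr0n addr0 => /eqP; rewrite eq_sym expf_eq0/= gt_eqF.
have Hc s t : H (s, t) = H (s, clamp 0 3 t).
  by rewrite /H /G /c /th /= (clamp_id (t := clamp 0 3 t)).
have c03 : c 0 = c 3.
  rewrite /c /th !clamp_id ?lexx ?ler0n// mulr0 divfK ?pnatr_eq0//.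
  by rewrite /cis cos0 sin0 [2 * pi]mulr_natl cos2pi sin2pi.
have Hab s : H (s, 0) = H (s, 3) by rewrite /H /G /= c03.
have T1 : has_turn (fun t => H (0, t)) 0 3 (2 * pi).
  exists th.
    split=> // t; exists e => //.
    by rewrite /H /= segm0 (gK (Dc t)).2 cm.
  by rewrite /th !clamp_id ?lexx ?ler0n// mulr0 divfK ?pnatr_eq0// subr0.
have T0 : has_turn (fun t => H (1, t)) 0 3 0.
  rewrite (_ : (fun t => _) = fun=> H (1, 0)); last first.
    by apply/funext => t; rewrite /H /= !segm1.
  exact: has_turn_cst.
have := has_turn_unique B0 (homotopy_has_turn B0 cH H0 Hc Hab 1 T1) T0.
by have := pi_gt0 R; lra.
Unshelve. all: by end_near. Qed.

End Surface.

Lemma triangulation_faces (R : realType) (V : choiceType) (K : complex2 V) :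
  plane_triangulation R K ->
  (forall u v w w', K u v w -> K u v w' -> w = w') /\
  (forall u v w, K u v w -> exists w', K v u w').
Proof.
move=> [D [h [oD _ _ [[g [ch cg hK gK]] wi]]]]; split.
  by move=> u v w w'; apply: (face_unique ch hK wi).
by move=> u v w; apply: (face_opposite oD ch cg hK gK wi).
Qed.

(** * Angles of flowers *)

Section Angles.
Context {R : realType}.
Local Open Scope complex_scope.
Implicit Types (a b c : R).

(* The angle at the first vertex of the triangle of the centers of three mutually
   tangent circles of radii a, b, c, by the law of cosines. *)
Definition angle a b c : R := acos (1 - 2 * (b * c / ((a + b) * (a + c)))).

Lemma angle_quot_itv a b c : 0 < a -> 0 < b -> 0 < c ->
  0 < b * c / ((a + b) * (a + c)) < 1.
Proof.
move=> a0 b0 c0; have d0 : 0 < (a + b) * (a + c) by rewrite mulr_gt0 ?addr_gt0.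
apply/andP; split; first by rewrite divr_gt0// mulr_gt0.
by rewrite ltr_pdivrMr// mul1r; nra.
Qed.

Lemma cos_angle a b c : 0 < a -> 0 < b -> 0 < c ->
  cos (angle a b c) = 1 - 2 * (b * c / ((a + b) * (a + c))).
Proof.
move=> a0 b0 c0; have /andP[q0 q1] := angle_quot_itv a0 b0 c0.
by rewrite acosK// in_itv/=; lra.
Qed.

Lemma angle_gt0 a b c : 0 < a -> 0 < b -> 0 < c -> 0 < angle a b c.
Proof.
move=> a0 b0 c0; have /andP[q0 q1] := angle_quot_itv a0 b0 c0.
by apply: acos_gt0; lra.
Qed.

Lemma angle_ltpi a b c : 0 < a -> 0 < b -> 0 < c -> angle a b c < pi.
Proof.
move=> a0 b0 c0; have /andP[q0 q1] := angle_quot_itv a0 b0 c0.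
by apply: acos_ltpi; lra.
Qed.

(** Enlarging a petal widens the angle that it subtends at the center; in [chain_angle_le] this
    compares the largest petal with the one whose place it would take. *)
Lemma angle_quot_le a b c c' : 0 < a -> 0 < b -> 0 < c -> c <= c' ->
  b * c / ((a + b) * (a + c)) <= b * c' / ((a + b) * (a + c')).
Proof.
move=> a0 b0 c0 cc'; have c0' := lt_le_trans c0 cc'.
have d0 : 0 < (a + b) * (a + c) by rewrite mulr_gt0 ?addr_gt0.
have d0' : 0 < (a + b) * (a + c') by rewrite mulr_gt0 ?addr_gt0.
rewrite ler_pdivrMr// mulrAC ler_pdivlMr//.
rewrite -subr_ge0 [X in 0 <= X](_ : _ = b * a * (a + b) * (c' - c)); last by ring.
by rewrite !mulr_ge0 ?subr_ge0// ?addr_ge0// ltW.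
Qed.

(** A unit vector for tangent circles, whose centers are at distance the sum of the radii. *)
Definition petal_dir (A B : @circle R) : R[i] :=
  (circle_center B - circle_center A) /
  (circle_radius A + circle_radius B)%:C.

Lemma sqn_tangent (A B : @circle R) : externally_tangent A B ->
  sqn (circle_center B - circle_center A) = (circle_radius A + circle_radius B) ^+ 2.
Proof.
by rewrite /externally_tangent => <-; rewrite sqn_normc -normcN opprB.
Qed.

(** The law of cosines determines the real part of the quotient of the two directions, hence the
    imaginary part up to sign; positive orientation selects the sign. *)
Lemma petal_dir_next (A B C : @circle R) :
  externally_tangent A B -> externally_tangent B C -> externally_tangent C A ->
  positively_oriented (circle_center A) (circle_center B) (circle_center C) ->
  petal_dir A C = petal_dir A B *
    cis (angle (circle_radius A) (circle_radius B) (circle_radius C)).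
Proof.
move=> /sqn_tangent AB /sqn_tangent BC /sqn_tangent CA.
rewrite /positively_oriented /petal_dir.
have := circle_radius_gt0 A; have := circle_radius_gt0 B; have := circle_radius_gt0 C.
set rA := circle_radius A in AB BC CA *; set rB := circle_radius B in AB BC CA *.
set rC := circle_radius C in AB BC CA * => c0 b0 a0.
have ca := cos_angle a0 b0 c0.
have sa : 0 < sin (angle rA rB rC).
  by apply: sin_gt0_pi; rewrite angle_gt0// angle_ltpi.
have e1 : sqn (circle_center C - circle_center A) = (rA + rC) ^+ 2.
  rewrite [rA + rC]addrC -CA /sqn; case: (circle_center A) (circle_center C) => ? ? [] ? ? /=; ring.
have e2 : circle_center C - circle_center B =
   (circle_center C - circle_center A) - (circle_center B - circle_center A) by ring.
rewrite e2 in BC; move: AB e1 BC.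
set p := circle_center B - _; set q := circle_center C - _ => hp hq hpq im.
have p0 : p != 0 by rewrite -sqn_gt0 hp exprn_gt0// addr_gt0.
have qE : q = q / p * p by rewrite divfK.
move: (q / p) qE im hp hq hpq; case: p p0 => x y p0 [s t] -> /= t0.
rewrite /sqn /= => hp hq hpq.
have L1 : 0 < rA + rB by rewrite addr_gt0.
have L2 : 0 < rA + rC by rewrite addr_gt0.
have L1n : rA + rB != 0 by rewrite gt_eqF.
have L2n : rA + rC != 0 by rewrite gt_eqF.
have st : (s ^+ 2 + t ^+ 2) * (rA + rB) ^+ 2 = (rA + rC) ^+ 2.
  by rewrite -hq -hp; ring.
have hs : s * (rA + rB) = (rA + rC) * cos (angle rA rB rC).
  have : s * (rA + rB) ^+ 2 = (rA + rC) * (rA + rB) * cos (angle rA rB rC).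
    rewrite ca; transitivity (((rA + rB) ^+ 2 + (rA + rC) ^+ 2 - (rB + rC) ^+ 2) / 2).
      by rewrite -hpq -hq -hp; field.
    by field; rewrite ?L1n ?L2n.
  by move=> h; apply: (mulIf L1n); rewrite -mulrA -expr2 h; ring.
have ht : t * (rA + rB) = (rA + rC) * sin (angle rA rB rC).
  apply/eqP; rewrite -(@eqrXn2 _ 2)// ?mulr_ge0 ?ltW//; apply/eqP.
  rewrite !exprMn.
  have -> : t ^+ 2 * (rA + rB) ^+ 2 = (rA + rC) ^+ 2 - (s * (rA + rB)) ^+ 2.
    by rewrite -st; ring.
  rewrite hs exprMn -[X in X - _]mulr1 -(cos2Dsin2 (angle rA rB rC)); ring.
apply: (@mulIf _ (rA + rC)%:C); first by rewrite (_ : 0 = (0:R)%:C)// (inj_eq (@complexI _)).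
rewrite divfK; last by rewrite (_ : 0 = (0:R)%:C)// (inj_eq (@complexI _)).
have -> : s +i* t = (rA + rC)%:C * cis (angle rA rB rC) / (rA + rB)%:C.
  apply: (@mulIf _ (rA + rB)%:C); first by rewrite (_ : 0 = (0:R)%:C)// (inj_eq (@complexI _)).
  rewrite divfK; last by rewrite (_ : 0 = (0:R)%:C)// (inj_eq (@complexI _)).
  by rewrite /cis; simpc; rewrite hs ht.
ring.
Qed.

(** If the centers were closer than the sum of the radii, the point dividing their segment in the
    ratio of the radii would be interior to both circles. *)
Lemma disjoint_circles (A B : @circle R) :
  circle_interior A `&` circle_interior B = set0 ->
  (circle_radius A + circle_radius B) ^+ 2 <= sqn (circle_center A - circle_center B).
Proof.
move=> AB; rewrite leNgt; apply/negP.
have a0 := circle_radius_gt0 A; have b0 := circle_radius_gt0 B.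
move: AB; rewrite /circle_interior; move: a0 b0.
set rA := circle_radius A; set rB := circle_radius B => a0 b0.
case: (circle_center A) (circle_center B) => x y [u v].
rewrite /sqn /= => AB h.
have L0 : 0 < rA + rB by rewrite addr_gt0.
have Ln : rA + rB != 0 by rewrite gt_eqF.
pose k := rA / (rA + rB); have k0 : 0 < k by rewrite divr_gt0.
have k1 : (1 - k) * (rA + rB) = rB by rewrite /k; field.
have k2 : k * (rA + rB) = rA by rewrite divfK.
clearbody k.
pose z := (x + k * (u - x)) +i* (y + k * (v - y)).
suff : set0 z by [].
rewrite -AB; split => /=.
  rewrite -[ltRHS]gtr0_norm// -sqrtr_sqr ltr_sqrt ?exprn_gt0//.
  rewrite -[rA in ltRHS]k2 [ltLHS](_ : _ = k ^+ 2 * ((x - u) ^+ 2 + (y - v) ^+ 2)).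
    by rewrite exprMn ltr_pM2l ?exprn_gt0.
  ring.
have k1' : 0 < 1 - k.
  by rewrite -(pmulr_lgt0 _ L0) k1.
rewrite -[ltRHS]gtr0_norm// -sqrtr_sqr ltr_sqrt ?exprn_gt0//.
rewrite -[rB in ltRHS]k1 [ltLHS](_ : _ = (1 - k) ^+ 2 * ((x - u) ^+ 2 + (y - v) ^+ 2)).
  by rewrite exprMn ltr_pM2l ?exprn_gt0.
ring.
Qed.

Section Chain.
Variables (A : @circle R) (C : nat -> @circle R) (n : nat).
Hypothesis n0 : (0 < n)%N.
Hypothesis tangent : forall i, externally_tangent A (C i).
Hypothesis chain : forall i, petal_dir A (C i.+1) = petal_dir A (C i) *
  cis (angle (circle_radius A) (circle_radius (C i)) (circle_radius (C i.+1))).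
Hypothesis closed_chain : C n = C 0%N.

Let a := circle_radius A.
Let r i := circle_radius (C i).
Let alpha i := angle a (r i) (r i.+1).
Let S i := \sum_(j < i) alpha j.
Let a0 : 0 < a. Proof. exact: circle_radius_gt0. Qed.
Let r0 i : 0 < r i. Proof. exact: circle_radius_gt0. Qed.
Let al0 i : 0 < alpha i. Proof. exact: angle_gt0. Qed.
Let alpi i : alpha i < pi. Proof. exact: angle_ltpi. Qed.

Let dirE i : petal_dir A (C i) = petal_dir A (C 0%N) * cis (S i).
Proof.
elim: i => [|i IH]; first by rewrite /S big_ord0 cis0 mulr1.
by rewrite chain IH /S big_ord_recr /= cisD mulrA.
Qed.

Let nC (x : R) : x != 0 -> x%:C != 0 :> R[i].
Proof. by move=> x0; rewrite (_ : 0 = (0:R)%:C)// (inj_eq (@complexI _)). Qed.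

Let centerE i : circle_center (C i) - circle_center A =
  (a + r i)%:C * petal_dir A (C i).
Proof.
by rewrite /petal_dir mulrC divfK// nC// gt_eqF// addr_gt0// r0.
Qed.

Let sqnM (p q : R[i]) : sqn (p * q) = sqn p * sqn q.
Proof. by rewrite /sqn; case: p q => ? ? [] ? ? /=; ring. Qed.

Let sqnC (x : R) : sqn x%:C = x ^+ 2.
Proof. by rewrite /sqn /= expr0n addr0. Qed.

Let sqn_dir i : sqn (petal_dir A (C i)) = 1.
Proof.
have L0 : 0 < a + r i by rewrite addr_gt0.
apply: (@mulfI _ ((a + r i) ^+ 2)); first by rewrite gt_eqF// exprn_gt0.
by rewrite -sqnC -sqnM -centerE sqn_tangent// sqnC mulr1.
Qed.

Let dir_n0 i : petal_dir A (C i) != 0.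
Proof. by rewrite -sqn_gt0 sqn_dir. Qed.

(** The direction returns to itself after a positive total angle, and the cosine is less than 1
    strictly between 0 and 2 pi. *)
Lemma chain_angle_ge : 2 * pi <= S n.
Proof.
have : cis (S n) = 1.
  by apply: (mulfI (dir_n0 0)); rewrite -dirE closed_chain mulr1.
case=> cS sS; rewrite leNgt; apply/negP => Sn.
have S0 : 0 < S n.
  case: n n0 => // m _; rewrite /S big_ord_recr /= ltr_wpDl// sumr_ge0// => i _.
  exact: ltW.
by have := @cos_lt1 R (S n); rewrite cS S0 Sn ltxx => /(_ isT).
Qed.

(* If the petals went around more than once, the largest one would sit between
   two consecutive ones, which are tangent to each other. *)
Lemma chain_angle_le :
  (forall i, (0 < i < n)%N -> circle_interior (C i) `&` circle_interior (C 0%N) = set0) ->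
  (forall i, r i <= r 0%N) -> S n <= 2 * pi.
Proof.
move=> disj rmax; rewrite leNgt; apply/negP => Sn.
have [m Sm mmin] := ex_minnP (ex_intro (fun i => 2 * pi < S i) n Sn).
have p0 := pi_gt0 R.
case: m Sm mmin => [|k]; first by rewrite /S big_ord0 => ?; lra.
move=> Sk mmin.
have kn : (k < n)%N by exact: mmin.
have Sk2 : S k <= 2 * pi.
  by rewrite leNgt; apply/negP => /mmin; rewrite ltnn.
have SS : S k.+1 = S k + alpha k by rewrite /S big_ord_recr.
have k0 : (0 < k)%N.
  rewrite lt0n; apply/eqP => k0; move: Sk; rewrite SS k0 /S big_ord0.
  by have := alpi 0; lra.
have b0 := al0 k; have b1 := alpi k.
(* The angle from petal [k] to petal 0. Minimality of [k.+1] places it between 0 and [alpha k]. *)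
pose beta := 2 * pi - S k.
have cb : cos (alpha k) < cos beta.
  by rewrite ltr_cos ?in_itv/=; rewrite /beta; lra.
have dir0 : petal_dir A (C 0%N) = petal_dir A (C k) * cis beta.
  rewrite (dirE k) -mulrA -cisD /beta [S k + _]addrC subrK.
  by rewrite /cis [2 * pi]mulr_natl cos2pi sin2pi mulr1.
have kd : (0 < k < n)%N by rewrite k0.
have := disjoint_circles (disj k kd).
have -> : circle_center (C k) - circle_center (C 0%N) =
  petal_dir A (C k) * ((a + r k)%:C - (a + r 0%N)%:C * cis beta).
  have -> : circle_center (C k) - circle_center (C 0%N) =
    (circle_center (C k) - circle_center A) - (circle_center (C 0%N) - circle_center A).
    by ring.
  by rewrite !centerE dir0; ring.
rewrite sqnM sqn_dir mul1r -!/(r _).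
have -> : sqn ((a + r k)%:C - (a + r 0%N)%:C * cis beta) =
  (a + r k) ^+ 2 + (a + r 0%N) ^+ 2 - 2 * (a + r k) * (a + r 0%N) * cos beta.
  rewrite /sqn /cis; simpc; rewrite /=.
  transitivity ((a + r k) ^+ 2 + (a + r 0%N) ^+ 2 * (cos beta ^+ 2 + sin beta ^+ 2)
    - 2 * (a + r k) * (a + r 0%N) * cos beta); first by ring.
  by rewrite cos2Dsin2 mulr1.
(* Since petal 0 is the largest, tangency to petal [k] would need an angle at least [alpha k], which
   exceeds [beta]: the two petals are too close to be disjoint. *)
rewrite (cos_angle a0 (r0 k) (r0 k.+1)) in cb.
have := angle_quot_le a0 (r0 k) (r0 k.+1) (rmax k.+1).
set q1 := _ / _ in cb *; set q2 := _ / _ => q12 h.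
have q2E : q2 * ((a + r k) * (a + r 0%N)) = r k * r 0%N.
  by rewrite divfK// gt_eqF// mulr_gt0// addr_gt0.
have d0 : 0 < (a + r k) * (a + r 0%N) by rewrite mulr_gt0// addr_gt0.
have : (a + r k) * (a + r 0%N) * (1 - 2 * q2) < (a + r k) * (a + r 0%N) * cos beta.
  by rewrite ltr_pM2l//; lra.
nra.
Qed.

End Chain.

End Angles.

(** The sum splits over the cycles of [s], each traversed from an element of largest [rk]; for
    petals [rk] is the radius, as [chain_angle_le] wants the largest petal at index 0. *)
Lemma perm_orbit_sum_ge0 (R : realType) (T : finType) (s : {perm T}) (F rk : T -> R) :
  (forall x n, (0 < n)%N -> iter n s x = x ->
     (forall i, (0 < i < n)%N -> iter i s x <> x) ->
     (forall i, rk (iter i s x) <= rk x) -> 0 <= \sum_(i < n) F (iter i s x)) ->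
  0 <= \sum_x F x.
Proof.
move=> H.
rewrite (partition_big (porbit s) (mem (porbits s)))/=; last first.
  by move=> x _; apply/imsetP; exists x.
apply: sumr_ge0 => _ /imsetP[z _ ->].
have zz := porbit_id s z.
pose x := [arg max_(x > z in porbit s z) rk x]%O.
have [xz xmax] : x \in porbit s z /\ forall y, y \in porbit s z -> rk y <= rk x.
  by rewrite /x; case: Order.TotalTheory.arg_maxP => // i iz imax; split=> // y /imax.
have Oxz : porbit s x = porbit s z by apply/eqP; rewrite eq_porbit_mem.
rewrite (eq_bigl (fun y => y \in porbit s x)); last first.
  by move=> y; rewrite -Oxz /= eq_porbit_mem.
rewrite (eq_bigl _ _ (porbit_traject s x)).
rewrite -big_uniq/=; last exact: uniq_traject_porbit.
set n := #|porbit s x|.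
have n0 : (0 < n)%N by rewrite card_gt0; apply/set0Pn; exists x; exact: porbit_id.
have -> : \sum_(i <- traject s x n) F i = \sum_(i < n) F (iter i s x).
  rewrite -[traject s x n](mkseq_nth x) size_traject big_map.
  rewrite -(big_mkord xpredT (fun i => F (iter i s x))) /index_iota subn0.
  rewrite [LHS]big_seq [RHS]big_seq; apply: eq_bigr => i.
  by rewrite mem_iota => /andP[_ ?]; rewrite nth_traject.
apply: H => //; first exact: iter_porbit.
  move=> i /andP[i0 ini] ix.
  have := uniq_traject_porbit s x; rewrite -/n => /(nth_uniq x).
  move=> /(_ i 0%N); rewrite size_traject => /(_ ini n0).
  rewrite !nth_traject//= ix eqxx; case: i i0 {ini ix} => //.
by move=> i; apply: xmax; rewrite -Oxz -permX; exact: mem_porbit.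
Qed.

(** * Variation of the angles of a triangle *)

Section TriangleVariation.
Context {R : realType}.
Implicit Types (a b c ga gb gc t : R).

(** Heron's formula: the triangle with sides a + b, b + c, c + a has semiperimeter a + b + c and
    area sqrt(abc(a + b + c)). *)
Definition inradius a b c : R := Num.sqrt (a * b * c / (a + b + c)).

Lemma inradius_rot a b c : inradius b c a = inradius a b c.
Proof. by rewrite /inradius; congr (Num.sqrt (_ / _)); ring. Qed.

Lemma is_derive_ext (f g : R -> R) t d d' :
  is_derive t 1 f d -> f = g -> d = d' -> is_derive t 1 g d'.
Proof. by move=> ? <- <-. Qed.

Lemma is_derive_angle (x y z : R -> R) t ga gb gc :
  0 < x t -> 0 < y t -> 0 < z t ->
  is_derive t 1 x (ga * x t) -> is_derive t 1 y (gb * y t) ->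
  is_derive t 1 z (gc * z t) ->
  is_derive t 1 (fun s => angle (x s) (y s) (z s))
    (inradius (x t) (y t) (z t) *
      ((gb - ga) / (x t + y t) + (gc - ga) / (x t + z t))).
Proof.
move=> x0 y0 z0 dx dy dz.
have d0 : (x t + y t) * (x t + z t) != 0 by rewrite gt_eqF// mulr_gt0// addr_gt0.
have dxy := is_deriveD dx dy; have dxz := is_deriveD dx dz.
have dden := is_deriveM dxy dxz.
have dinv := @is_deriveV R ((x + y) * (x + z)) t _ 1 d0 dden.
have dnum := is_deriveM dy dz.
have dq := is_deriveM dnum dinv.
have dq2 := is_deriveB (is_derive_cst (1 : R) t 1) (is_deriveZ 2 dq).
(* The squared area of the triangle; twice the area is the product of two sides by the sine of their
   angle, which gives [sE]. *)
pose Q := x t * y t * z t * (x t + y t + z t).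
have Q0 : 0 < Q by rewrite /Q !mulr_gt0// !addr_gt0.
have /andP[q0 q1] := angle_quot_itv x0 y0 z0.
pose f s := 1 - 2 * (y s * z s / ((x s + y s) * (x s + z s))).
have {dq2} [l df lE] : exists2 l, is_derive t 1 f l & l = 0 - 2 *
    (y t * z t * (- ((x t + y t) * (x t + z t)) ^- 2 *
    ((x t + y t) * (ga * x t + gc * z t) + (x t + z t) * (ga * x t + gb * y t))) +
    ((x t + y t) * (x t + z t))^-1 * (y t * (gc * z t) + z t * (gb * y t))).
  by eexists; [exact: dq2|].
have h1 : -1 < f t < 1 by rewrite /f; lra.
have da := is_derive1_comp (is_derive1_acos h1) df.
have Qs : Num.sqrt Q ^+ 2 = Q by rewrite sqr_sqrtr// ltW.
have W0 : 0 < Num.sqrt Q by rewrite sqrtr_gt0.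
set W := Num.sqrt Q in Qs W0.
have Wn : W != 0 by rewrite gt_eqF.
have n1 : x t + y t != 0 by rewrite gt_eqF// addr_gt0.
have n2 : x t + z t != 0 by rewrite gt_eqF// addr_gt0.
have n3 : x t + y t + z t != 0 by rewrite gt_eqF// !addr_gt0.
have rE : inradius (x t) (y t) (z t) = x t * y t * z t / W.
  rewrite /inradius -[RHS]ger0_norm; last by rewrite divr_ge0 ?ltW// !mulr_gt0.
  rewrite -sqrtr_sqr; congr Num.sqrt; rewrite expr_div_n Qs /Q.
  by field; rewrite n3 !gt_eqF.
have sE : Num.sqrt (1 - f t ^+ 2) = 2 * W / ((x t + y t) * (x t + z t)).
  rewrite -[RHS]ger0_norm; last by rewrite divr_ge0 ?mulr_ge0 ?ltW ?mulr_gt0 ?addr_gt0.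
  rewrite -sqrtr_sqr; congr Num.sqrt; rewrite expr_div_n exprMn Qs /Q /f.
  by field; rewrite n1 n2.
apply: is_derive_eq da _; rewrite sE rE lE.
by field; rewrite n1 n2 Wn.
Qed.

(* A lower bound of inradius / length of an edge when all radii are in [lo, hi]. *)
Definition variation_const (lo hi : R) := Num.sqrt (lo ^+ 3 / (3 * hi)) / (2 * hi).

(* The mean value theorem along the geometric interpolation of the radii; the point
   it gives depends on the weights p1, p2, p3, but kappa does not. *)
Lemma angle_variation a b c a' b' c' : 0 < a -> 0 < b -> 0 < c ->
    0 < a' -> 0 < b' -> 0 < c' ->
  exists2 kappa, 0 < kappa & forall p1 p2 p3, exists k : R * R * R,
  [/\ kappa <= k.1.1 <= 2^-1, kappa <= k.1.2 <= 2^-1, kappa <= k.2 <= 2^-1 &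
  p1 * (angle a' b' c' - angle a b c) + p2 * (angle b' c' a' - angle b c a) +
  p3 * (angle c' a' b' - angle c a b) =
  k.1.1 * (p1 - p2) * (ln (b' / b) - ln (a' / a)) +
  k.1.2 * (p2 - p3) * (ln (c' / c) - ln (b' / b)) +
  k.2 * (p3 - p1) * (ln (a' / a) - ln (c' / c))].
Proof.
move=> a0 b0 c0 a0' b0' c0'.
pose fl (u v : R) t := u * expR (t * ln (v / u)).
have fl_gt0 u v t : 0 < u -> 0 < fl u v t by move=> u0; rewrite mulr_gt0// expR_gt0.
have fl0 u v : fl u v 0 = u by rewrite /fl mul0r expR0 mulr1.
have fl1 u v : 0 < u -> 0 < v -> fl u v 1 = v.
  by move=> u0 v0; rewrite /fl mul1r lnK ?posrE ?divr_gt0// mulrC divfK// gt_eqF.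
have dfl u v t : is_derive t 1 (fl u v) (ln (v / u) * fl u v t).
  have d1 : is_derive t 1 (fun s : R => s * ln (v / u)) (ln (v / u)).
    have := is_deriveM (is_derive_id t 1) (is_derive_cst (ln (v / u)) t (1 : R)).
    by move/is_derive_ext; apply; rewrite // /cst /GRing.scale/= mulr0 add0r mulr1.
  have d2 := @is_derive1_comp R expR (fun s => s * ln (v / u)) t _ _
    (is_derive_expR (t * ln (v / u))) d1.
  have := is_deriveM (is_derive_cst u t (1 : R)) d2.
  by move/is_derive_ext; apply; rewrite // /fl /cst /GRing.scale/=; ring.
pose lo := Num.min (Num.min (Num.min a a') (Num.min b b')) (Num.min c c').
pose hi := Num.max (Num.max (Num.max a a') (Num.max b b')) (Num.max c c').
have lo0 : 0 < lo by rewrite !lt_min a0 b0 c0 a0' b0' c0'.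
have flb u v t : 0 < u -> 0 < v -> lo <= u <= hi -> lo <= v <= hi -> 0 <= t <= 1 ->
    lo <= fl u v t <= hi.
  move=> u0 v0 /andP[u1 u2] /andP[v1 v2] /andP[t0 t1].
  have h0 : 0 < hi by exact: lt_le_trans u2.
  have flE : fl u v t = expR ((1 - t) * ln u + t * ln v).
    rewrite /fl ln_div ?posrE// -{1}[u]lnK ?posrE// -expRD; congr expR; ring.
  rewrite flE -[lo]lnK ?posrE// -[hi]lnK ?posrE// !ler_expR.
  have : ln lo <= ln u by rewrite ler_ln ?posrE.
  have : ln lo <= ln v by rewrite ler_ln ?posrE.
  have : ln u <= ln hi by rewrite ler_ln ?posrE.
  have : ln v <= ln hi by rewrite ler_ln ?posrE.
  set lu := ln u; set lv := ln v; set ll := ln lo; set lh := ln hi; nra.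
have bnd : [/\ lo <= a <= hi, lo <= b <= hi & lo <= c <= hi].
  by rewrite /lo /hi !ge_min !le_max !lexx !orbT.
have bnd' : [/\ lo <= a' <= hi, lo <= b' <= hi & lo <= c' <= hi].
  by rewrite /lo /hi !ge_min !le_max !lexx !orbT.
have [ba bb bc] := bnd; have [ba' bb' bc'] := bnd'.
have hi0 : 0 < hi by case/andP: ba => _; exact: lt_le_trans.
exists (variation_const lo hi).
  by rewrite divr_gt0 ?sqrtr_gt0 ?divr_gt0 ?exprn_gt0 ?mulr_gt0.
(* The lower bound is crude. The upper one is xyz / (x + y + z) <= xy <= ((x + y) / 2)^2; with the
   two faces at an edge it yields total conductance at most 1. *)
have kb x y z : lo <= x <= hi -> lo <= y <= hi -> lo <= z <= hi ->
    variation_const lo hi <= inradius x y z / (x + y) <= 2^-1.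
  move=> /andP[x1 x2] /andP[y1 y2] /andP[z1 z2].
  have x0 : 0 < x by lra. have y0 : 0 < y by lra. have z0 : 0 < z by lra.
  have s0 : 0 < x + y + z by rewrite !addr_gt0.
  apply/andP; split.
    apply: ler_pM; rewrite ?invr_ge0 ?sqrtr_ge0//; first by lra.
      apply: ler_wsqrtr; apply: ler_pM; rewrite ?invr_ge0 ?exprn_ge0//; try lra.
        rewrite exprS expr2 mulrA; apply: ler_pM => //; try lra.
          by rewrite mulr_ge0; lra.
        by apply: ler_pM => //; lra.
      by rewrite lef_pV2 ?posrE; lra.
    by rewrite lef_pV2 ?posrE; lra.
  rewrite ler_pdivrMr ?addr_gt0//.
  rewrite -[leRHS]ger0_norm; last by lra.
  rewrite -sqrtr_sqr; apply: ler_wsqrtr.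
  rewrite ler_pdivrMr//; apply: (@le_trans _ _ (x * y * (x + y + z))).
    by rewrite ler_wpM2l ?mulr_ge0 ?ltW// ltr_pwDl ?addr_gt0.
  rewrite ler_wpM2r ?(ltW s0)//; have := sqr_ge0 (x - y); lra.
move=> p1 p2 p3.
pose F t := p1 * angle (fl a a' t) (fl b b' t) (fl c c' t) +
  p2 * angle (fl b b' t) (fl c c' t) (fl a a' t) +
  p3 * angle (fl c c' t) (fl a a' t) (fl b b' t).
pose ga := ln (a' / a); pose gb := ln (b' / b); pose gc := ln (c' / c).
pose dF t := inradius (fl a a' t) (fl b b' t) (fl c c' t) *
  (p1 * ((gb - ga) / (fl a a' t + fl b b' t) + (gc - ga) / (fl a a' t + fl c c' t)) +
   p2 * ((gc - gb) / (fl b b' t + fl c c' t) + (ga - gb) / (fl b b' t + fl a a' t)) +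
   p3 * ((ga - gc) / (fl c c' t + fl a a' t) + (gb - gc) / (fl c c' t + fl b b' t))).
have i1 t : inradius (fl b b' t) (fl c c' t) (fl a a' t) =
  inradius (fl a a' t) (fl b b' t) (fl c c' t) by exact: inradius_rot.
have i2 t : inradius (fl c c' t) (fl a a' t) (fl b b' t) =
  inradius (fl a a' t) (fl b b' t) (fl c c' t) by rewrite inradius_rot i1.
have dF' (t : R) : is_derive t 1 F (dF t).
  have d1 := is_derive_angle (fl_gt0 _ a' t a0) (fl_gt0 _ b' t b0) (fl_gt0 _ c' t c0)
    (dfl _ _ _) (dfl _ _ _) (dfl _ _ _).
  have d2 := is_derive_angle (fl_gt0 _ b' t b0) (fl_gt0 _ c' t c0) (fl_gt0 _ a' t a0)
    (dfl _ _ _) (dfl _ _ _) (dfl _ _ _).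
  have d3 := is_derive_angle (fl_gt0 _ c' t c0) (fl_gt0 _ a' t a0) (fl_gt0 _ b' t b0)
    (dfl _ _ _) (dfl _ _ _) (dfl _ _ _).
  have := is_deriveD (is_deriveD (is_deriveZ p1 d1) (is_deriveZ p2 d2)) (is_deriveZ p3 d3).
  move/is_derive_ext; apply; rewrite // /dF /GRing.scale/=.
  rewrite i2 i1.
  rewrite -!/ga -!/gb -!/gc; ring.
have [] := @MVT R F dF 0 1 ltr01 (fun t _ => dF' t).
  apply: derivable_within_continuous => t _; exact: ex_derive.
move=> t; rewrite in_itv/= => /andP[t0 t1] FE.
have t01 : 0 <= t <= 1 by rewrite !ltW.
have xa := flb _ _ t a0 a0' ba ba' t01.
have xb := flb _ _ t b0 b0' bb bb' t01.
have xc := flb _ _ t c0 c0' bc bc' t01.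
exists (inradius (fl a a' t) (fl b b' t) (fl c c' t) / (fl a a' t + fl b b' t),
  inradius (fl b b' t) (fl c c' t) (fl a a' t) / (fl b b' t + fl c c' t),
  inradius (fl c c' t) (fl a a' t) (fl b b' t) / (fl c c' t + fl a a' t)).
split => /=; try exact: kb.
transitivity (F 1 - F 0); first by rewrite /F !fl0 !fl1//; ring.
(* Each edge occurs in the angles at its two ends with the same coefficient and opposite differences
   of logarithms, hence the factors [p1 - p2], [p2 - p3], [p3 - p1]. *)
rewrite FE subr0 mulr1 /dF i2 i1.
rewrite -!/ga -!/gb -!/gc.
rewrite [fl b b' t + fl a a' t]addrC [fl c c' t + fl b b' t]addrC [fl a a' t + fl c c' t]addrC.
ring.
Qed.

End TriangleVariation.

(** * Recurrence and cut-off functions *)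

(** Every open disk contains a rational point, and disjoint disks contain different ones.
    Countability is used in [walk_finite_start]. *)
Lemma univalent_countable (R : realType) (V : choiceType) (P : V -> @circle R) :
  univalent P -> exists e : V -> nat, injective e.
Proof.
move=> uP.
have rat_pt v : exists q : rat * rat,
    circle_interior (P v) (Complex (ratr q.1) (ratr q.2)).
  have r0 := circle_radius_gt0 (P v).
  set r := circle_radius (P v) in r0.
  case E : (circle_center (P v)) => [x y].
  have [q1] := @rat_in_itvoo R (x - r / 2) (x + r / 2) ltac:(lra).
  rewrite in_itv/= => /andP[q1l q1r].
  have [q2] := @rat_in_itvoo R (y - r / 2) (y + r / 2) ltac:(lra).
  rewrite in_itv/= => /andP[q2l q2r].
  exists (q1, q2); rewrite /circle_interior /= E -/r.
  rewrite -[ltRHS]gtr0_norm// -sqrtr_sqr ltr_sqrt ?exprn_gt0//.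
  have h1 : (ratr q1 - x) ^+ 2 < (r / 2) ^+ 2 by nra.
  have h2 : (ratr q2 - y) ^+ 2 < (r / 2) ^+ 2 by nra.
  nra.
pose q v := sval (cid (rat_pt v)).
exists (fun v => choice.pickle (q v)) => u v /(pcan_inj choice.pickleK) quv.
apply: contrapT => uv; have := uP u v uv.
have qu : circle_interior (P u) (Complex (ratr (q u).1) (ratr (q u).2)).
  exact: (svalP (cid (rat_pt u))).
have qv : circle_interior (P v) (Complex (ratr (q u).1) (ratr (q u).2)).
  by rewrite quv; exact: (svalP (cid (rat_pt v))).
by move=> uv0; have : set0 (Complex (ratr (q u).1 : R) (ratr (q u).2)) by rewrite -uv0.
Qed.

Section Walk.
Context {R : realType} {V : choiceType}.
Variable N : V -> set V.

(* The probability that the walk started at x visits o by time m. *)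
Fixpoint hit_prob (o : V) (m : nat) (x : V) : R :=
  if m is m'.+1 then
    if x == o then 1
    else (\sum_(y <- fset_set (N x)) hit_prob o m' y) / #|` fset_set (N x)|%:R
  else (x == o)%:R.

Lemma hit_origin o m : hit_prob o m o = 1.
Proof. by case: m => [|m] /=; rewrite eqxx. Qed.

Section OneWalk.
Context (d : measure_display) (T : measurableType d) (Pr : probability T R).
Variables (X : nat -> T -> V) (x0 : V).
Hypothesis walk : simple_random_walk N x0 Pr X.

Let cyl n (p : nat -> V) := [set t | forall i, (i <= n)%N -> X i t = p i].
Let avoid o n m := [set t | forall j, (j <= m)%N -> X (n + j)%N t <> o].
Let weight n (p : nat -> V) : R :=
  (p 0%N == x0)%:R * \prod_(i < n) step_probability R N (p i) (p i.+1).

Let cylE n p : Pr (cyl n p) = (weight n p)%:E.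
Proof. exact: walk.2. Qed.

Let m_cyl n p : measurable (cyl n p).
Proof.
rewrite (_ : cyl n p = \bigcap_(i in `I_n.+1) (X i @^-1` [set p i])).
  by apply: fin_bigcap_measurable => // i _; exact: walk.1.
by apply/seteqP; split=> t h i; apply: h.
Qed.

Let m_avoid o n m : measurable (avoid o n m).
Proof.
rewrite (_ : avoid o n m = \bigcap_(j in `I_m.+1) ~` (X (n + j)%N @^-1` [set o])).
  by apply: fin_bigcap_measurable => // i _; apply: measurableC; exact: walk.1.
by apply/seteqP; split=> t h i; apply: h.
Qed.

(** [fset_set] of an infinite set is empty, so all one-step cylinders from [x0] would have
    probability 0. Countably many of them cover the event of starting at [x0], which has probability
    1. *)
Lemma walk_finite_start (e : V -> nat) : injective e -> finite_set (N x0).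
Proof.
move=> ei; apply: contrapT => infN.
have null v : Pr (cyl 1 (fun i => if i == 0%N then x0 else v)) = 0%E.
  rewrite cylE /weight big_ord1 /= /step_probability.
  have -> : fset_set (N x0) = fset0 by rewrite /fset_set; case: pselect.
  by rewrite cardfs0 invr0 !mulr0.
have negl : Pr.-negligible (cyl 0 (fun=> x0)).
  pose F k := [set t | X 0%N t = x0 /\ e (X 1%N t) = k].
  apply: (@negligibleS _ _ _ Pr (\bigcup_k F k)).
    by move=> t tx; exists (e (X 1%N t)) => //; split=> //; exact: tx.
  apply: negligible_bigcup => k.
  have [[v vk]|nv] := pselect (exists v, e v = k); last first.
    apply: (@negligibleS _ _ _ Pr set0); last exact: negligible_set0.
    by move=> t [_ ek]; apply: nv; exists (X 1%N t).
  apply: (@negligibleS _ _ _ Pr (cyl 1 (fun i => if i == 0%N then x0 else v))).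
    move=> t [t0 t1] [|[|i]]//= _; apply: ei; by rewrite vk.
  by exists (cyl 1 (fun i => if i == 0%N then x0 else v)); split; [exact: m_cyl|exact: null|].
have h := measure_negligible (m_cyl _ _) negl.
have : (weight 0 (fun=> x0))%:E = 0%E by rewrite -cylE; exact: h.
by rewrite /weight eqxx big_ord0 mulr1 => -[] /eqP; rewrite oner_eq0.
Qed.

Hypothesis finN : forall x, finite_set (N x).
Hypothesis neN : forall x, exists y, N x y.

Let deg_gt0 x : 0 < #|` fset_set (N x)|%:R :> R.
Proof.
rewrite ltr0n cardfs_gt0; have [y Ny] := neN x.
by apply/fset0Pn; exists y; rewrite in_fset_set// inE.
Qed.

Let ext (p : nat -> V) n y i := if (i <= n)%N then p i else y.

Let weight_ext n p y : N (p n) y ->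
  weight n.+1 (ext p n y) = weight n p / #|` fset_set (N (p n))|%:R.
Proof.
move=> Ny; rewrite /weight big_ord_recr /= {1}/ext leq0n -!mulrA; congr (_ * _).
congr (_ * _); first by apply: eq_bigr => i _; rewrite /ext ltn_ord ltnW.
by rewrite /ext leqnn ltnn /step_probability indicE mem_set// mul1r.
Qed.

Let weight_ge0 n p : 0 <= weight n p.
Proof.
by rewrite /weight mulr_ge0// prodr_ge0// => i _; rewrite /step_probability mulr_ge0.
Qed.

(** The Markov property, as a lower bound: the cylinders over the neighbors of [p n] are disjoint
    and, with the avoidance from the next step on, lie in the event on the right. The past [p] is
    general because the induction lengthens it. *)
Let avoid_ge o m : forall n p,
  ((weight n p * (1 - hit_prob o m (p n)))%:E <= Pr (cyl n p `&` avoid o n m))%E.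
Proof.
elim: m => [|m IH] n p.
  rewrite /=; have [_|pno] := eqVneq (p n) o.
    by rewrite subrr mulr0; exact: measure_ge0.
  rewrite subr0 mulr1 -cylE; apply: le_measure; rewrite ?inE//; first exact: measurableI.
  move=> t tp; split=> // j; rewrite leqn0 => /eqP ->; rewrite addn0 tp//.
  exact/eqP.
have [po|pno] := eqVneq (p n) o.
  by rewrite po hit_origin subrr mulr0; exact: measure_ge0.
set S := fset_set (N (p n)).
pose A y := cyl n.+1 (ext p n y) `&` avoid o n.+1 m.
apply: (@le_trans _ _ (\sum_(y <- S) Pr (A y))%E).
  apply: (@le_trans _ _ (\sum_(y <- S)
      (weight n p / #|` S|%:R * (1 - hit_prob o m y))%:E)%E).
    rewrite sumEFin lee_fin /= (negbTE pno) -/S -mulr_sumr sumrB.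
    rewrite big_const_seq count_predT iter_addr_0 -mulrA ler_wpM2l ?weight_ge0//.
    by rewrite mulrBr mulVf ?gt_eqF ?deg_gt0// [X in _ - X <= _]mulrC.
  rewrite big_seq [leRHS]big_seq; apply: lee_sum => y yS.
  have Ny : N (p n) y by move: yS; rewrite in_fset_set// inE.
  have := IH n.+1 (ext p n y); rewrite weight_ext//.
  by have -> : ext p n y n.+1 = y by rewrite /ext ltnn.
rewrite -measure_fbigsetU; last 2 first.
- by move=> y _; exact: measurableI.
- move=> y y' _ _ [t [[ty _] [ty' _]]].
  have := ty n.+1 (leqnn _); rewrite (ty' n.+1 (leqnn _)).
  by rewrite /ext ltnn.
apply: le_measure; rewrite ?inE.
- by rewrite -bigcup_fset; apply: fin_bigcup_measurable => // y _; exact: measurableI.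
- exact: measurableI.
rewrite -bigcup_fset => t [y _ [ty tav]]; split.
  by move=> i lein; rewrite ty ?(leqW lein)// /ext lein.
case=> [_|j jm]; last by rewrite addnS -addSn; exact: tav.
by rewrite addn0 ty ?leqnSn// /ext leqnn; exact/eqP.
Qed.

(** The events of avoiding [o] up to time [m] decrease to an event disjoint from the almost sure
    one, so their probabilities tend to 0. *)
Lemma hit_to1 o : Pr [set t | forall m, exists2 n, (m <= n)%N & X n t = o] = 1%E ->
  forall eps : R, 0 < eps -> exists m, 1 - eps < hit_prob o m x0.
Proof.
set io := [set t | _] => Pio eps eps0.
have m_io : measurable io.
  rewrite (_ : io = \bigcap_m \bigcup_(n in [set n | (m <= n)%N]) (X n @^-1` [set o])).
    apply: bigcapT_measurable => m; apply: bigcup_measurable => n _; exact: walk.1.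
  apply/seteqP; split=> t h m => [_|]; first by have [n mn <-] := h m; exists n.
  by have [n mn <-] := h m I; exists n.
have cv : Pr \o (avoid o 0) @ \oo --> Pr (\bigcap_m avoid o 0 m).
  apply: nonincreasing_cvg_mu.
  - by rewrite (le_lt_trans (probability_le1 Pr (m_avoid _ _ _)))// ltry.
  - exact: m_avoid.
  - by apply: bigcapT_measurable => m; exact: m_avoid.
  - by move=> m n mn; apply/subsetPset => t h j jm; apply: h; exact: leq_trans mn.
have cap0 : Pr (\bigcap_m avoid o 0 m) = 0%E.
  apply/eqP; rewrite eq_le measure_ge0 andbT.
  have <- : Pr (~` io) = 0%E by rewrite probability_setC// Pio subee.
  apply: le_measure; rewrite ?inE.
  - by apply: bigcapT_measurable => m; exact: m_avoid.
  - exact: measurableC.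
  - by move=> t h /(_ 0%N)[n _ Xn]; exact: (h n I n (leqnn n)).
rewrite cap0 in cv.
have eps0' : (0 < eps%:E)%E by rewrite lte_fin.
have [m Hm] : exists m, (Pr (avoid o 0 m) < eps%:E)%E.
  have /fine_cvg/cvgr_lt/(_ _ eps0)[m _ h] := cv; exists m.
  have := h m (leqnn m); rewrite /= -lte_fin fineK//.
  by rewrite fin_num_measure//; exact: m_avoid.
exists m; rewrite ltrBlDr -ltrBlDl -lte_fin; apply: le_lt_trans Hm.
apply: (@le_trans _ _ (Pr (cyl 0 (fun=> x0) `&` avoid o 0 m))).
  by have := avoid_ge o m 0 (fun=> x0); rewrite /weight eqxx big_ord0 !mul1r.
apply: le_measure; rewrite ?inE; [exact: measurableI|exact: m_avoid|].
exact: subIsetr.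
Qed.

End OneWalk.

Hypothesis finN : forall x, finite_set (N x).
Hypothesis neN : forall x, exists y, N x y.
Hypothesis symN : forall x y, N x y -> N y x.

Lemma deg_neq0 x : #|` fset_set (N x)|%:R != 0 :> R.
Proof.
rewrite pnatr_eq0 -lt0n cardfs_gt0; have [y Ny] := neN x.
by apply/fset0Pn; exists y; rewrite in_fset_set// inE.
Qed.

Lemma hit_ge0 o m x : 0 <= hit_prob o m x.
Proof.
elim: m x => [|m IH] x //=; case: ifP => // _.
by rewrite divr_ge0// sumr_ge0.
Qed.

Lemma hit_le1 o m x : hit_prob o m x <= 1.
Proof.
elim: m x => [|m IH] x /=; first by case: (x == o).
case: ifP => // _; rewrite ler_pdivrMr ?lt_def ?deg_neq0//= mul1r.
apply: (@le_trans _ _ (\sum_(y <- fset_set (N x)) 1)); first exact: ler_sum.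
by rewrite big_const_seq count_predT iter_addr_0.
Qed.

Lemma hit_mono o m x : hit_prob o m x <= hit_prob o m.+1 x.
Proof.
elim: m x => [|m IH] x.
  by rewrite [hit_prob o 0 x]/=; case: eqVneq => [->|_]; [rewrite hit_origin|exact: hit_ge0].
rewrite [leLHS]/= [leRHS]/=; case: ifP => // _.
by rewrite ler_wpM2r ?invr_ge0//; apply: ler_sum => y _; exact: IH.
Qed.

Lemma hit_mono_le o m n x : (m <= n)%N -> hit_prob o m x <= hit_prob o n x.
Proof.
move/subnK <-; elim: (n - m)%N => // k IH; rewrite addSn.
exact: le_trans (hit_mono _ _ _).
Qed.

Lemma hit_support o m : exists A : {fset V}, forall x, x \notin A -> hit_prob o m x = 0.
Proof.
elim: m => [|m [A HA]].
  by exists [fset o]%fset => x; rewrite inE /= => /negbTE ->.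
exists (o |` \bigcup_(y <- A) fset_set (N y))%fset => x.
rewrite !inE negb_or => /andP[/negbTE xo xA] /=; rewrite xo big_seq big1 ?mul0r// => y.
rewrite in_fset_set// inE => Nxy; apply: HA; apply: contra xA => yA.
apply/bigfcupP; exists y; first by rewrite yA.
by rewrite in_fset_set// inE; exact: symN.
Qed.

(** A positive hitting probability produces a path to [o]; in this form it replaces the
    connectedness of the 1-skeleton. *)
Lemma hit_gt0_invariant (Y : Type) (g : V -> Y) o m x :
  (forall x y, N x y -> g x = g y) -> 0 < hit_prob o m x -> g x = g o.
Proof.
move=> gN; elim: m x => [|m IH] x /=.
  by case: eqVneq => [->|_]//; rewrite ltxx.
case: eqVneq => [->//|_ h].
have [[y Nxy hy]|none] := pselect (exists2 y, N x y & 0 < hit_prob o m y).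
  by rewrite (gN _ _ Nxy); exact: IH.
move: h; rewrite big_seq big1 ?mul0r ?ltxx// => y; rewrite in_fset_set// inE => Nxy.
apply/eqP; rewrite eq_le hit_ge0 andbT leNgt; apply/negP => hy; apply: none.
by exists y.
Qed.

(** Summation by parts. Away from [o], the average over the neighbors is the probability for time
    [m.+1], which is no smaller, so such vertices contribute at most 0; at [o] the function is 1. *)
Lemma hit_energy o m (B : {fset V}) : o \in B ->
  (forall x y, hit_prob o m x != 0 -> N x y -> y \in B) ->
  (forall x, hit_prob o m x != 0 -> x \in B) ->
  \sum_(x <- B) \sum_(y <- B | `[< N x y >]) (hit_prob o m x - hit_prob o m y) ^+ 2 <=
  2 * \sum_(y <- fset_set (N o)) (1 - hit_prob o m y).
Proof.
move=> oB BN Bs; set f := hit_prob o m.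
have -> : \sum_(x <- B) \sum_(y <- B | `[< N x y >]) (f x - f y) ^+ 2 =
    2 * \sum_(x <- B) \sum_(y <- B | `[< N x y >]) f x * (f x - f y).
  have sw : \sum_(x <- B) \sum_(y <- B | `[< N x y >]) f x * (f x - f y) =
      \sum_(x <- B) \sum_(y <- B | `[< N x y >]) f y * (f y - f x).
    under eq_bigr do rewrite big_mkcond.
    under [RHS]eq_bigr do rewrite big_mkcond.
    rewrite exchange_big /=; apply: eq_bigr => x _; apply: eq_bigr => y _.
    have -> // : `[< N y x >] = `[< N x y >] by apply: asbool_equiv_eq; split; exact: symN.
  rewrite mulr_natl mulr2n {2}sw -big_split /=; apply: eq_bigr => x _.
  by rewrite -big_split /=; apply: eq_bigr => y _; ring.
rewrite ler_pM2l ?ltr0n//.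
have inner x : x \in B -> \sum_(y <- B | `[< N x y >]) f x * (f x - f y) <=
    if x == o then \sum_(y <- fset_set (N o)) (1 - f y) else 0.
  move=> xB; have [fx0|fx0] := eqVneq (f x) 0.
    rewrite fx0 big1 => [|y _]; last by rewrite mul0r.
    by case: ifP => // _; rewrite sumr_ge0// => y _; rewrite subr_ge0 hit_le1.
  have -> : \sum_(y <- B | `[< N x y >]) f x * (f x - f y) =
      \sum_(y <- fset_set (N x)) f x * (f x - f y).
    rewrite -big_filter; apply: perm_big; apply: uniq_perm.
    - by rewrite filter_uniq// fset_uniq.
    - exact: fset_uniq.
    move=> y; rewrite mem_filter in_fset_set//; apply/andP/idP.
      by move=> [/asboolP Nxy _]; rewrite inE.
    by move=> /set_mem Nxy; split; [exact/asboolP|exact: BN Nxy].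
  case: eqVneq => [->|xo]; first by rewrite /f hit_origin; under eq_bigr do rewrite mul1r.
  rewrite -mulr_sumr sumrB big_const_seq count_predT iter_addr_0.
  rewrite mulr_ge0_le0 ?hit_ge0// subr_le0.
  have := hit_mono o m x; rewrite /= (negbTE xo) -/f ler_pdivlMr; last first.
    by rewrite lt_def deg_neq0 ler0n.
  by rewrite mulr_natr.
rewrite big_seq; apply: (@le_trans _ _ (\sum_(x <- B | x \in B)
    if x == o then \sum_(y <- fset_set (N o)) (1 - f y) else 0)).
  by apply: ler_sum.
rewrite -big_seq (big_fsetD1 o)//= eqxx.
rewrite [X in _ + X <= _]big1_seq ?addr0// => x /andP[_].
by rewrite !inE => /andP[/negbTE -> _].
Qed.

End Walk.

(** * The log-ratio is constant *)

(** Grouped by edges, the weighted gains are three products to which the ground state transform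
    applies; conductances at most 1/2 give the energy, and one of the three negative squares is
    kept. [kappa] is chosen before the weights so that it serves all cut-off functions. *)
Lemma face_dirichlet (R : realType) (a b c a' b' c' : R) : 0 < a -> 0 < b -> 0 < c ->
    0 < a' -> 0 < b' -> 0 < c' ->
  exists2 kappa, 0 < kappa & forall f1 f2 f3 h1 h2 h3 : R,
  1 <= h1 -> 1 <= h2 -> 1 <= h3 ->
  ln (b' / b) - ln (a' / a) = h1 - h2 ->
  ln (c' / c) - ln (b' / b) = h2 - h3 ->
  ln (a' / a) - ln (c' / c) = h3 - h1 ->
  f1 ^+ 2 / h1 * (angle a' b' c' - angle a b c) +
  f2 ^+ 2 / h2 * (angle b' c' a' - angle b c a) +
  f3 ^+ 2 / h3 * (angle c' a' b' - angle c a b) <=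
  2^-1 * ((f1 - f2) ^+ 2 + (f2 - f3) ^+ 2 + (f3 - f1) ^+ 2) -
  kappa * (f1 / h1 - f2 / h2) ^+ 2.
Proof.
move=> a0 b0 c0 a0' b0' c0'.
have [kappa k0 H] := angle_variation a0 b0 c0 a0' b0' c0'.
exists kappa => // f1 f2 f3 h1 h2 h3 h1g h2g h3g e12 e23 e31.
have [[[k12 k23] k31] /= [/andP[k1 k1'] /andP[k2 k2'] /andP[k3 k3'] ->]] :=
  H (f1 ^+ 2 / h1) (f2 ^+ 2 / h2) (f3 ^+ 2 / h3).
rewrite e12 e23 e31.
(* Ground state transform: k (x^2/p - y^2/q) (p - q) = k (x - y)^2 - k p q (x/p - y/q)^2. *)
have main (k x y p q : R) : kappa <= k -> k <= 2^-1 -> 1 <= p -> 1 <= q ->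
    k * (x ^+ 2 / p - y ^+ 2 / q) * (p - q) <=
    2^-1 * (x - y) ^+ 2 - kappa * (x / p - y / q) ^+ 2.
  move=> kk kk' p1 q1.
  have p0 : p != 0 by rewrite gt_eqF// (lt_le_trans _ p1).
  have q0 : q != 0 by rewrite gt_eqF// (lt_le_trans _ q1).
  have -> : k * (x ^+ 2 / p - y ^+ 2 / q) * (p - q) =
      k * (x - y) ^+ 2 - k * (p * q) * (x / p - y / q) ^+ 2.
    by field; rewrite p0 q0.
  apply: lerB; first by rewrite ler_wpM2r// sqr_ge0.
  rewrite ler_wpM2r ?sqr_ge0//; apply: (le_trans kk).
  by rewrite ler_peMr ?mulr_ege1// (le_trans (ltW k0)).
have m1 := main _ f1 f2 h1 h2 k1 k1' h1g h2g.
have m2 := main _ f2 f3 h2 h3 k2 k2' h2g h3g.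
have m3 := main _ f3 f1 h3 h1 k3 k3' h3g h1g.
have s2 : 0 <= kappa * (f2 / h2 - f3 / h3) ^+ 2 by rewrite mulr_ge0 ?sqr_ge0 ?ltW.
have s3 : 0 <= kappa * (f3 / h3 - f1 / h1) ^+ 2 by rewrite mulr_ge0 ?sqr_ge0 ?ltW.
lra.
Qed.

(** * Flowers and summation over faces *)

Section Flower.
Context {R : realType} {V : choiceType}.
Variable K : complex2 V.
Hypothesis faceU : forall u v w w', K u v w -> K u v w' -> w = w'.
Hypothesis faceE : forall u v w, K u v w -> exists w', K v u w'.

Lemma neighborsP u v : neighbors K u v <-> exists w, K u v w.
Proof.
split=> [[w [h|h]]|[w h]]; [by exists w|exact: faceE h|by exists w; left].
Qed.

Lemma neighbors_sym u v : neighbors K u v -> neighbors K v u.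
Proof. by move=> [w [h|h]]; exists w; [right|left]. Qed.

Hypothesis finN : forall x, finite_set (neighbors K x).

Definition third x y : V := xget y [set z | K x y z].

Lemma thirdP x y : neighbors K x y -> K x y (third x y).
Proof. by move/neighborsP => h; exact: (xgetPex y h). Qed.

Lemma neighbors_third x y : neighbors K x y -> neighbors K x (third x y).
Proof. by move=> /thirdP h; exists y; right; exact: face_rot (face_rot h). Qed.

Variables P Q : V -> @circle R.
Hypothesis P_packing : circle_packing K P.
Hypothesis P_univalent : univalent P.
Hypothesis Q_packing : circle_packing K Q.

Let rP v := circle_radius (P v).
Let rQ v := circle_radius (Q v).

Definition angle_gain x y z : R :=
  angle (rQ x) (rQ y) (rQ z) - angle (rP x) (rP y) (rP z).

(** By [faceU], the passage to the next petal is injective, hence a permutation of the finitely many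
    petals. On each cycle the angles add up to at most 2 pi in [P] and at least 2 pi in [Q]. *)
Lemma flower_gain_ge0 x :
  0 <= \sum_(y <- fset_set (neighbors K x)) angle_gain x y (third x y).
Proof.
set S := fset_set _.
have SN y : (y \in S) = (y \in neighbors K x) by rewrite in_fset_set.
have SP (y : S) : neighbors K x (val y) by have := valP y; rewrite SN inE.
have nS (y : S) : third x (val y) \in S.
  by rewrite SN inE; exact: neighbors_third.
pose f (y : S) : S := [` nS y]%fset.
have f_inj : injective f.
  move=> y y' /(congr1 val) /= e; apply: val_inj.
  have h := thirdP (SP y); have h' := thirdP (SP y'); rewrite -e in h'.
  exact: faceU (face_rot (face_rot h)) (face_rot (face_rot h')).
pose s : {perm S} := perm f_inj.
rewrite big_seq_fsetE /=.
apply: (@perm_orbit_sum_ge0 R S s (fun y => angle_gain x (val y) (third x (val y)))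
  (fun y => rP (val y))).
move=> y n n0 yn ymin ymax.
pose c i := val (iter i s y).
have cS i : neighbors K x (c i) by exact: SP.
have cnext i : c i.+1 = third x (c i) by rewrite /c iterS permE.
have face_c i : K x (c i) (c i.+1) by rewrite cnext; exact: thirdP.
have tang (Z : V -> @circle R) (Z_packing : circle_packing K Z) i :
  externally_tangent (Z x) (Z (c i)) by have [] := Z_packing _ _ _ (face_c i).
have chain (Z : V -> @circle R) (Z_packing : circle_packing K Z) i :
  petal_dir (Z x) (Z (c i.+1)) = petal_dir (Z x) (Z (c i)) *
    cis (angle (circle_radius (Z x)) (circle_radius (Z (c i))) (circle_radius (Z (c i.+1)))).
  by have [? ? ? ?] := Z_packing _ _ _ (face_c i); exact: petal_dir_next.
have cn : c n = c 0%N by rewrite /c yn.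
have PH := @chain_angle_le R (P x) (P \o c) n (tang P P_packing) (chain P P_packing).
have QH := @chain_angle_ge R (Q x) (Q \o c) n n0 (tang Q Q_packing) (chain Q Q_packing)
  (congr1 Q cn).
rewrite /angle_gain -/(c _) sumrB subr_ge0.
under eq_bigr do rewrite -/(c _) -cnext.
under [leRHS]eq_bigr do rewrite -/(c _) -cnext.
apply: le_trans QH; apply: PH => [i i0n|i]; last exact: ymax.
by apply: P_univalent => e; apply: (ymin i i0n); exact: val_inj.
Qed.

Lemma flower_sumE x (B : {fset V}) (F : V -> V -> R) :
  (forall y, neighbors K x y -> y \in B) ->
  \sum_(y <- B) \sum_(z <- B) (if `[< K x y z >] then F y z else 0) =
  \sum_(y <- fset_set (neighbors K x)) F y (third x y).
Proof.
move=> NB.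
have inner y : \sum_(z <- B) (if `[< K x y z >] then F y z else 0) =
    if `[< neighbors K x y >] then F y (third x y) else 0.
  case: asboolP => [Nxy|Nxy]; last first.
    rewrite big1 // => z _; case: asboolP => // Kxyz.
    by exfalso; apply: Nxy; exists z; left.
  rewrite (big_fsetD1 (third x y))/=; last by apply: NB; exact: neighbors_third.
  rewrite asboolT; last exact: thirdP.
  rewrite big_seq big1 ?addr0// => z; rewrite !inE => /andP[/eqP zn _].
  case: asboolP => // Kxyz; exfalso; apply: zn; exact: faceU Kxyz (thirdP Nxy).
under eq_bigr do rewrite inner.
rewrite -big_mkcond /= -big_filter; apply: perm_big; apply: uniq_perm.
- by rewrite filter_uniq// fset_uniq.
- exact: fset_uniq.
move=> y; rewrite mem_filter in_fset_set//; apply/andP/idP.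
  by move=> [/asboolP Nxy _]; exact/mem_set.
by move=> /set_mem Nxy; split; [exact/asboolP|exact: NB].
Qed.

(** Each face with vertices in [B] is counted three times, once per rotation. *)
Definition face_sum (B : {fset V}) (F : V -> V -> V -> R) : R :=
  \sum_(x <- B) \sum_(y <- B) \sum_(z <- B) (if `[< K x y z >] then F x y z else 0).

Lemma face_sum_rot B F : face_sum B (fun x y z => F y z x) = face_sum B F.
Proof.
have rot x y z : `[< K x y z >] = `[< K y z x >].
  by apply: asbool_equiv_eq; split=> [/face_rot//|/face_rot/face_rot].
rewrite /face_sum exchange_big /=; apply: eq_bigr => y _.
rewrite exchange_big /=; apply: eq_bigr => z _; apply: eq_bigr => x _.
by rewrite rot.
Qed.

Lemma face_sumD B F G :
  face_sum B (fun x y z => F x y z + G x y z) = face_sum B F + face_sum B G.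
Proof.
rewrite /face_sum -big_split /=; apply: eq_bigr => x _.
rewrite -big_split /=; apply: eq_bigr => y _.
rewrite -big_split /=; apply: eq_bigr => z _.
by case: ifP => _; rewrite ?addr0.
Qed.

Lemma face_sumZ B k F : face_sum B (fun x y z => k * F x y z) = k * face_sum B F.
Proof.
rewrite /face_sum mulr_sumr; apply: eq_bigr => x _.
rewrite mulr_sumr; apply: eq_bigr => y _.
rewrite mulr_sumr; apply: eq_bigr => z _.
by case: ifP => _; rewrite ?mulr0.
Qed.

Lemma ler_face_sum B F G : (forall x y z, K x y z -> F x y z <= G x y z) ->
  face_sum B F <= face_sum B G.
Proof.
move=> FG; do 3![apply: ler_sum => ? _].
by case: asboolP => // /FG.
Qed.

Lemma face_sum_delta B a b c k : a \in B -> b \in B -> c \in B -> K a b c ->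
  face_sum B (fun x y z => if [&& x == a, y == b & z == c] then k else 0) = k.
Proof.
move=> aB bB cB Kabc.
have D v (F : V -> R) : v \in B -> (forall x, x != v -> F x = 0) ->
    \sum_(x <- B) F x = F v.
  move=> vB F0; rewrite (big_fsetD1 v)//= big_seq big1 ?addr0// => x.
  by rewrite !inE => /andP[/F0].
rewrite /face_sum (D a)//; last first.
  by move=> x /negbTE xa; do 2![rewrite big1 // => ? _]; rewrite xa; case: ifP.
rewrite (D b)//; last first.
  by move=> x /negbTE xa; rewrite big1 // => ? _; rewrite xa andbF; case: ifP.
rewrite (D c)//; last by move=> x /negbTE xa; rewrite xa !andbF; case: ifP.
by rewrite !eqxx asboolT.
Qed.

(** An oriented edge determines its face, so it is counted at most once, and not at all when the
    third vertex is outside [B]. *)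
Lemma face_sum_edge B (F : V -> V -> R) : (forall x y, 0 <= F x y) ->
  face_sum B (fun x y _ => F x y) <=
  \sum_(x <- B) \sum_(y <- B | `[< neighbors K x y >]) F x y.
Proof.
move=> F0; apply: ler_sum => x _; rewrite [leRHS]big_mkcond; apply: ler_sum => y _.
have [/asboolP Nxy|nN] := boolP `[< neighbors K x y >]; last first.
  rewrite big1 // => z _; case: asboolP => // Kxyz; case/negP: nN.
  by apply/asboolP; exists z; left.
have [tB|tB] := boolP (third x y \in B).
  rewrite (big_fsetD1 (third x y))//= asboolT; last exact: thirdP.
  rewrite big_seq big1 ?addr0// => z; rewrite !inE => /andP[/eqP zn _].
  case: asboolP => // Kxyz; exfalso; apply: zn; exact: faceU Kxyz (thirdP Nxy).
rewrite big_seq big1 // => z zB; case: asboolP => // Kxyz; exfalso.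
by move/negP: tB; apply; rewrite (faceU (thirdP Nxy) Kxyz).
Qed.

Let g v : R := ln (rQ v / rP v).

Variable M : R.
Hypothesis g_le : forall v, g v <= M.
(** The shift by 1 gives [1 <= h], so that the factor [h x * h y] of the ground state transform can
    be bounded below by 1. *)
Let h v := M + 1 - g v.
Let h1 v : 1 <= h v. Proof. by rewrite /h; have := g_le v; lra. Qed.

Lemma cutoff_energy a b c (phi : V -> R) (A B : {fset V}) : K a b c ->
  (forall x, x \notin A -> phi x = 0) ->
  (forall x, x \in A -> x \in B) ->
  (forall x y, x \in A -> neighbors K x y -> y \in B) ->
  a \in B -> b \in B -> c \in B ->
  forall kappa : R,
  (forall f1 f2 f3 h1 h2 h3 : R,
    1 <= h1 -> 1 <= h2 -> 1 <= h3 ->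
    g b - g a = h1 - h2 -> g c - g b = h2 - h3 -> g a - g c = h3 - h1 ->
    f1 ^+ 2 / h1 * angle_gain a b c + f2 ^+ 2 / h2 * angle_gain b c a +
    f3 ^+ 2 / h3 * angle_gain c a b <=
    2^-1 * ((f1 - f2) ^+ 2 + (f2 - f3) ^+ 2 + (f3 - f1) ^+ 2) -
    kappa * (f1 / h1 - f2 / h2) ^+ 2) ->
  kappa * (phi a / h a - phi b / h b) ^+ 2 <=
  3 / 2 * \sum_(x <- B) \sum_(y <- B | `[< neighbors K x y >]) (phi x - phi y) ^+ 2.
Proof.
move=> Kabc phi0 AB NB aB bB cB kappa Hk.
set k0 := kappa * _.
pose psi x := phi x ^+ 2 / h x.
pose G x y z := psi x * angle_gain x y z.
have SG : 0 <= face_sum B G.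
  rewrite /face_sum sumr_ge0// => x _.
  have [xA|xA] := boolP (x \in A); last first.
    rewrite big1 // => y _; rewrite big1 // => z _; rewrite /G /psi phi0//.
    by rewrite expr0n /= !mul0r; case: ifP.
  rewrite (@flower_sumE x B (G x)); last by move=> y; exact: NB.
  rewrite /G -mulr_sumr mulr_ge0 ?flower_gain_ge0// divr_ge0 ?sqr_ge0//.
  by apply: le_trans (h1 x).
pose E x y (z : V) : R := (phi x - phi y) ^+ 2.
pose delta x y z : R := if [&& x == a, y == b & z == c] then k0 else 0.
have tri x y z : K x y z -> G x y z + G y z x + G z x y + delta x y z <=
    2^-1 * (E x y z + E y z x + E z x y).
  move=> Kxyz; rewrite /delta.
  have e u v : g u - g v = h v - h u by rewrite /h; lra.
  case: and3P => [[/eqP -> /eqP -> /eqP ->]|_].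
    have := Hk (phi a) (phi b) (phi c) (h a) (h b) (h c) (h1 _) (h1 _) (h1 _)
      (e _ _) (e _ _) (e _ _).
    by rewrite /G /psi /E /k0; lra.
  have rP0 v : 0 < rP v := circle_radius_gt0 (P v).
  have rQ0 v : 0 < rQ v := circle_radius_gt0 (Q v).
  have [k k0' H] := face_dirichlet (rP0 x) (rP0 y) (rP0 z) (rQ0 x) (rQ0 y) (rQ0 z).
  have := H (phi x) (phi y) (phi z) (h x) (h y) (h z) (h1 _) (h1 _) (h1 _)
      (e _ _) (e _ _) (e _ _).
  have : 0 <= k * (phi x / h x - phi y / h y) ^+ 2 by rewrite mulr_ge0 ?sqr_ge0 ?ltW.
  by rewrite /G /psi /E /angle_gain; lra.
have := ler_face_sum B tri.
rewrite face_sumD face_sum_delta// !face_sumD face_sumZ !face_sumD.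
rewrite (face_sum_rot B G) (face_sum_rot B E).
rewrite -[face_sum B (fun x y z => G z x y)]face_sum_rot.
rewrite -[face_sum B (fun x y z => E z x y)]face_sum_rot.
have -> : face_sum B (fun x y z => G x y z) = face_sum B G by [].
have -> : face_sum B (fun x y z => E x y z) = face_sum B E by [].
have := @face_sum_edge B (fun x y => (phi x - phi y) ^+ 2) (fun x y => sqr_ge0 _).
by rewrite -/(face_sum B E); lra.
Qed.

(** With cut-off functions centered at [a], the energy tends to 0 while the values at [a] and [b]
    are 1 and tend to 1; the square kept on [ab] gives [1 / h a = 1 / h b]. *)
Lemma log_ratio_neighbor :
  (forall o x (eps : R), 0 < eps -> exists m, 1 - eps < hit_prob (R := R) (neighbors K) o m x) ->
  forall x y, neighbors K x y -> g x = g y.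
Proof.
move=> hit1 a b /neighborsP[c Kabc].
have neN x : exists y, neighbors K x y.
  by have [v [w F]] := face_cover K x; exists v, w; left.
pose f m := @hit_prob R V (neighbors K) a m.
pose S := fset_set (neighbors K a).
have near1 eps : 0 < eps -> exists m, forall y, y \in S -> 1 - eps < f m y.
  move=> eps0; suff aux (s : seq V) : exists m, forall y, y \in s -> 1 - eps < f m y.
    exact: (aux (enum_fset S)).
  elim: s => [|y s [m IH]]; first by exists 0%N.
  have [m' Hm'] := hit1 a y eps eps0.
  exists (maxn m m') => z; rewrite inE => /predU1P[->|zs].
    apply: lt_le_trans Hm' _; apply: hit_mono_le; exact: leq_maxr.
  by apply: lt_le_trans (IH z zs) _; apply: hit_mono_le; exact: leq_maxl.
have rP0 v : 0 < rP v := circle_radius_gt0 (P v).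
have rQ0 v : 0 < rQ v := circle_radius_gt0 (Q v).
have [k k0 H] := face_dirichlet (rP0 a) (rP0 b) (rP0 c) (rQ0 a) (rQ0 b) (rQ0 c).
have bound m : k * (1 / h a - f m b / h b) ^+ 2 <= 3 * \sum_(y <- S) (1 - f m y).
  have [A HA] := @hit_support R V (neighbors K) finN neighbors_sym a m.
  pose B := (A `|` (\bigcup_(y <- A) fset_set (neighbors K y)) `|` [fset a; b; c])%fset.
  have AB x : x \in A -> x \in B by move=> xA; rewrite !inE xA.
  have NB x y : x \in A -> neighbors K x y -> y \in B.
    move=> xA Nxy; rewrite !inE; apply/orP; left; apply/orP; right.
    by apply/bigfcupP; exists x; rewrite ?xA// in_fset_set// inE.
  have abc : [/\ a \in B, b \in B & c \in B] by rewrite !inE !eqxx !orbT.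
  have [aB bB cB] := abc.
  have fA x : f m x != 0 -> x \in A by apply: contraR => xA; rewrite /f HA.
  have := @cutoff_energy a b c (f m) A B Kabc HA AB NB aB bB cB k H.
  rewrite {1}/f hit_origin => /le_trans; apply.
  have := @hit_energy R V (neighbors K) finN neN neighbors_sym a m B aB
    (fun x y fx => NB x y (fA x fx)) (fun x fx => AB x (fA x fx)).
  by rewrite -/(f m) -/S; lra.
have bS : b \in S by rewrite in_fset_set// inE; apply/neighborsP; exists c.
suff : 1 / h a = 1 / h b.
  have ha : h a != 0 by rewrite gt_eqF// (lt_le_trans ltr01).
  have hb : h b != 0 by rewrite gt_eqF// (lt_le_trans ltr01).
  by rewrite !div1r => /invr_inj; rewrite /h; lra.
pose del := 1 / h a - 1 / h b.
apply/eqP; rewrite -subr_eq0 -/del; apply/negP => /negP del0.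
pose n : R := (size S)%:R.
have n0 : 0 < n by rewrite ltr0n cardfs_gt0; apply/fset0Pn; exists b.
have ad0 : 0 < `|del| by rewrite normr_gt0.
have kd : 0 < k * del ^+ 2 by rewrite mulr_gt0// lt_def sqr_ge0 sqrf_eq0 del0.
(* The first bound keeps the square at least [del ^+ 2 / 4]; the second makes the energy bound at
   most [k * del ^+ 2 / 8]. *)
pose eps := Num.min (`|del| / 2) (k * del ^+ 2 / (24 * n)).
have eps0 : 0 < eps.
  by rewrite lt_min divr_gt0//= divr_gt0// mulr_gt0.
have eps1 : eps <= `|del| / 2 by rewrite ge_min lexx.
have eps2 : 3 * (n * eps) <= k * del ^+ 2 / 8.
  have : eps <= k * del ^+ 2 / (24 * n) by rewrite ge_min lexx orbT.
  rewrite ler_pdivlMr ?mulr_gt0//; lra.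
have [m Hm] := near1 eps eps0.
have fb := Hm b bS; have fb1 := @hit_le1 R V (neighbors K) finN neN a m b.
have := bound m.
have : \sum_(y <- S) (1 - f m y) <= n * eps.
  rewrite mulr_natl -iter_addr_0 -count_predT -big_const_seq.
  by rewrite big_seq [leRHS]big_seq; apply: ler_sum => y /Hm; lra.
have hb1 := h1 b.
have hb0 : 0 < h b by exact: lt_le_trans hb1.
have -> : 1 / h a - f m b / h b = del + (1 - f m b) / h b.
  by rewrite /del; field; rewrite !gt_eqF ?(lt_le_trans _ (h1 a)).
set t := (1 - f m b) / h b.
have t0 : 0 <= t by apply: divr_ge0; [rewrite subr_ge0|exact: ltW].
have t1 : t <= eps.
  rewrite ler_pdivrMr//; apply: (@le_trans _ _ eps); first by lra.
  by rewrite ler_peMr// ltW.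
have sq : (`|del| / 2) ^+ 2 <= (del + t) ^+ 2.
  rewrite -[leRHS]real_normK ?num_real//; apply: lerXn2r; rewrite ?nnegrE ?divr_ge0//.
  have := lerB_dist del (- t); rewrite opprK normrN (ger0_norm t0); lra.
have sq' : k * (`|del| / 2) ^+ 2 <= k * (del + t) ^+ 2 by rewrite ler_wpM2l// ltW.
have dd : k * (`|del| / 2) ^+ 2 = k * del ^+ 2 / 4.
  by rewrite expr_div_n real_normK ?num_real//; field.
lra.
Qed.

End Flower.

(** * From the vertices to the whole carrier *)

Lemma realization_sum (R : realType) (V : choiceType) (K : complex2 V) (x : V -> R)
    (F : V -> R) : realization K x ->
  exists2 A : {fset V}, \sum_(v <- A) x v = 1 &
  \sum_(v \in [set: V]) x v * F v = \sum_(v <- A) x v * F v.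
Proof.
move=> [u [v [w [F' x0 xn xs]]]]; exists [fset u; v; w]%fset.
  have [uv vw wu] := face_distinct F'.
  rewrite (big_fsetD1 u) ?inE ?eqxx//= (big_fsetD1 v)/=; last first.
    by rewrite !inE eqxx orbT andbT eq_sym.
  rewrite (big_fsetD1 w)/=; last by rewrite !inE eqxx orbT wu eq_sym vw.
  rewrite big_seq big1 ?addr0 ?addrA// => y.
  by rewrite !inE; case: (y == u) => //; case: (y == v) => //; case: (y == w).
apply: fsbigTE => y; rewrite !inE !negb_or -andbA => /and3P[/eqP yu /eqP yv /eqP yw].
by rewrite xn// mul0r.
Qed.

Lemma vertex_realization (R : realType) (V : choiceType) (K : complex2 V) (v : V) :
  realization K (vertex v : V -> R).
Proof.
have [u [w F]] := face_cover K v; have [vu uw wv] := face_distinct F.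
exists v, u, w; split=> //; rewrite /vertex.
- by move=> z /eqP/negbTE ->.
- by rewrite eqxx eq_sym (negbTE vu) (negbTE wv) !addr0.
Qed.

Theorem corollary3p3 (R : realType) (V : choiceType) (K : complex2 V)
    (K_triangulation : plane_triangulation R K)
    (P : V -> @circle R) (P_packing : circle_packing K P)
    (P_univalent : univalent P) (P_carrier : carrier K P = [set: R[i]])
    (Q : V -> @circle R) (Q_packing : circle_packing K Q)
    (f : R[i] -> R[i]) (f_cp_map : cp_map K P Q f)
    (fs : R[i] -> R) (fs_ratio : ratio_function K P Q fs)
    (K_recurrent : recurrent R (neighbors K)) :
  ~ [bounded fs z | z in carrier K P] \/
  (exists c : R, forall z, carrier K P z -> fs z = c).
Proof.
have [bd|] := pselect [bounded fs z | z in carrier K P]; [right|by left].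
have [faceU faceE] := triangulation_faces K_triangulation.
have [e e_inj] := univalent_countable P_univalent.
have finN x : finite_set (neighbors K x).
  have [d [T [Pr [X [walk _]]]]] := K_recurrent x.
  exact: (walk_finite_start walk e_inj).
have neN x : exists y, neighbors K x y.
  by have [v [w F]] := face_cover K x; exists v, w; left.
have hit1 o x (eps : R) : 0 < eps ->
    exists m, 1 - eps < hit_prob (R := R) (neighbors K) o m x.
  have [d [T [Pr [X [walk rec]]]]] := K_recurrent x.
  exact: (hit_to1 walk finN neN (rec o)).
pose ratio v := circle_radius (Q v) / circle_radius (P v).
have ratio_gt0 v : 0 < ratio v by rewrite divr_gt0 ?circle_radius_gt0.
have fs_vertex v : fs (center_map P (vertex v)) = ratio v.
  rewrite fs_ratio; last exact: vertex_realization.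
  rewrite (@fsbigTE R 0 _ V [fset v]%fset) ?big_seq_fset1 /vertex ?eqxx ?mul1r//.
  by move=> y; rewrite inE => /negbTE ->; rewrite mul0r.
have [M HM] : exists M, forall v, ln (ratio v) <= M.
  (* Boundedness provides bounds only by numbers greater than [M0]; [|M0| + 1] is one of them, and
     is positive, so that its logarithm is meaningful. *)
  case: bd => M0 [_ bd]; exists (ln (`|M0| + 1)) => v.
  have vK : carrier K P (center_map P (vertex v)).
    by exists (vertex v) => //; exact: vertex_realization.
  have B0 : 0 < `|M0| + 1 by rewrite ltr_wpDl.
  rewrite ler_ln ?posrE// -fs_vertex.
  apply: (le_trans (ler_norm _)); apply: bd => //.
  by rewrite (le_lt_trans (ler_norm _))// ltrDl.
have ratio_const x o : ratio x = ratio o.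
  (* Any value below 1 would do: what matters is a positive probability to reach [o] from [x]. *)
  have [m hm] := hit1 o x 2^-1 ltac:(by []).
  have gN := log_ratio_neighbor faceU faceE finN P_packing P_univalent Q_packing HM hit1.
  have := @hit_gt0_invariant R V (neighbors K) finN R _ o m x gN.
  by move=> E; apply: (ln_inj _ _ (E _)); rewrite ?posrE; [exact: ratio_gt0|exact: ratio_gt0|lra].
have [x0 Kx0 _] : carrier K P 0 by rewrite P_carrier.
have [u _] := Kx0; exists (ratio u) => _ [x Kx <-].
rewrite fs_ratio//; have [A xA ->] := realization_sum ratio Kx.
by under eq_bigr do rewrite (ratio_const _ u); rewrite -mulr_suml xA mul1r.
Qed.
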